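(* Let $d,p,s\geq 1$ be integers, $T>0$, let $\mathcal{X}\subset\mathbb{R}^d$ be compact and $\mathcal{U}\subset\mathbb{R}^p$ be compact and convex, and let $f:[0,T]\times\mathcal{X}\times\mathcal{U}\to\mathbb{R}^d$, $L:[0,T]\times\mathcal{X}\times\mathcal{U}\to\mathbb{R}$ and $M:\mathcal{X}\to\mathbb{R}$. Let $V^*\in C^1([0,T]\times\mathcal{X})$ be a solution of the Hamilton-Jacobi-Bellman equation $$\frac{\partial V^*}{\partial t}(t,x)+\inf_{u\in\mathcal{U}}\left(L(t,x,u)+\nabla_x V^*(t,x)^\top f(t,x,u)\right)=0,\qquad V^*(T,x)=M(x),$$ for all $(t,x)\in[0,T]\times\mathcal{X}$, where for every $(t,x)$ the infimum over $u\in\mathcal{U}$ is attained. Define $$H^*(t,x,u):=\frac{\partial V^*}{\partial t}(t,x)+L(t,x,u)+\nabla_x V^*(t,x)^\top f(t,x,u),$$ $\Omega_2:=\mathrm{Int}(\mathcal{U})$, $\Omega_1:=\mathrm{Int}\{(t,x)\in[0,T]\times\mathcal{X}\ :\ \operatorname{argmin}_{u\in\mathcal{U}}H^*(t,x,u)\subset\Omega_2\}$ and $\Omega:=\Omega_1\times\Omega_2$. Assume that: (i) $f$ is control-affine: there are functions $g:[0,T]\times\mathcal{X}\to\mathbb{R}^d$ and $B:[0,T]\times\mathcal{X}\to\mathbb{R}^{d\times p}$ such that $f(t,x,u)=g(t,x)+B(t,x)u$ for all $(t,x,u)\in[0,T]\times\mathcal{X}\times\mathcal{U}$; (ii) for all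 $(t,x)\in\Omega_1$, the function $u\mapsto L(t,x,u)$ is twice differentiable on $\Omega_2$ and strongly convex there, i.e. there is some $\rho>0$ such that $\nabla_u^2L(t,x,u)\succcurlyeq\rho I$ for all $u\in\Omega_2$; and the map $(t,x,u)\mapsto\nabla_u^2L(t,x,u)$ belongs to $C^s(\Omega)$; (iii) the map $(t,x,u)\mapsto\nabla_uL(t,x,u)+B(t,x)^\top\nabla_xV^*(t,x)$ belongs to $C^s(\Omega)$. Then there exist $p$ real-valued functions $w_1,\dots,w_p\in C^s(\Omega)$ such that $$\forall (t,x,u)\in\Omega,\qquad H^*(t,x,u)=\sum_{j=1}^p w_j(t,x,u)^2.$$
   Context: $\nabla_x$ denotes the gradient with respect to $x$; $\nabla_u$ and $\nabla_u^2$ denote the gradient and Hessian with respect to $u$. $\mathrm{Int}$ denotes the topological interior, taken in $\mathbb{R}^{1+d}$ for subsets of $[0,T]\times\mathcal{X}$ and in $\mathbb{R}^p$ for $\mathcal{U}$. $C^s(\Omega)$ denotes the $s$ times continuously differentiable functions on the open set $\Omega$ (vector- and matrix-valued maps are in $C^s(\Omega)$ when all their entries are). $A\succcurlyeq B$ means that $A-B$ is symmetric positive semi-definite. *)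

(* Defs.v *)
From HB Require Import structures.
From mathcomp Require Export all_boot all_order all_algebra.
From mathcomp Require Export all_classical all_reals all_analysis.
Export Order.TTheory GRing.Theory Num.Theory.
Export numFieldNormedType.Exports.

Set Implicit Arguments.
Unset Strict Implicit.
Unset Printing Implicit Defensive.

Local Open Scope classical_set_scope.
Local Open Scope ring_scope.

(* Points of R^n are column vectors; a time-state pair is z : R * 'cV[R]_d, and
   a time-state-control triple is w : R * 'cV[R]_d * 'cV[R]_p, so that
   w.1 = (t, x) and w.2 = u. Functions whose domain is a subset are total
   functions whose values are only constrained on that subset. *)

(* h is k times continuously differentiable on the set D, meant for D open and
   E finite-dimensional: there, continuity of the differential is continuity
   of all the directional derivatives of a differentiable function. *)
Fixpoint Ck (R : realType) (E : normedModType R) (k : nat) (D : set E)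
    (h : E -> R) : Prop :=
  if k is k'.+1 then
    (forall x, D x -> differentiable h x) /\ forall v, Ck k' D ('D_v h)
  else forall x, D x -> {for x, continuous h}.

Definition dotv (R : realType) (n : nat) (a b : 'cV[R]_n) : R :=
  (a^T *m b) ord0 ord0.

Definition grad (R : realType) (n : nat) (h : 'cV[R]_n -> R) (x : 'cV[R]_n) :
    'cV[R]_n :=
  \col_i 'D_(delta_mx i ord0) h x.

Definition hess (R : realType) (n : nat) (h : 'cV[R]_n -> R) (x : 'cV[R]_n) :
    'M[R]_n :=
  \matrix_(i, j) 'D_(delta_mx j ord0) (fun y => grad h y i ord0) x.

Definition twice_differentiable_on (R : realType) (n : nat) (D : set 'cV[R]_n)
    (h : 'cV[R]_n -> R) : Prop :=
  forall x, D x -> differentiable h x /\ differentiable (grad h) x.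

Definition psd_ge (R : realType) (n : nat) (A B : 'M[R]_n) : Prop :=
  (A - B)^T = A - B /\ forall v : 'cV[R]_n, 0 <= dotv v ((A - B) *m v).

Definition argmin (R : realType) (T : Type) (A : set T) (h : T -> R) : set T :=
  [set u | A u /\ forall v, A v -> h u <= h v].

(* V is C^1 on K, with dV/dt = Vt and grad_x V = gV. As K need not be open (nor
   the closure of its interior), the differential is taken relative to K and is
   not determined by V in general, whence the arguments Vt and gV. On the
   interior of K these are the usual derivatives; the restriction to K of a C^1
   function on a neighbourhood of K, with the derivatives of that function, is
   a particular case. *)
Definition C1_within (R : realType) (d : nat) (K : set (R * 'cV[R]_d))
    (V Vt : R * 'cV[R]_d -> R) (gV : R * 'cV[R]_d -> 'cV[R]_d) : Prop :=
  [/\ {within K, continuous Vt},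
      {within K, continuous gV} &
      forall z, K z -> forall e : R, 0 < e ->
        \forall y \near within K (nbhs z),
          `|V y - V z - (Vt z * (y.1 - z.1) + dotv (gV z) (y.2 - z.2))|
          <= e * `|y - z|].

Section OptimalControl.
Variables (R : realType) (d p : nat).
Variables (f : R * 'cV[R]_d -> 'cV[R]_p -> 'cV[R]_d).
Variables (L : R * 'cV[R]_d -> 'cV[R]_p -> R).
Variables (V Vt : R * 'cV[R]_d -> R) (gV : R * 'cV[R]_d -> 'cV[R]_d).
Variables (T : R) (X : set 'cV[R]_d) (U : set 'cV[R]_p) (M : 'cV[R]_d -> R).

Definition time_state : set (R * 'cV[R]_d) := `[0, T] `*` X.

(* The second conjunct (the infimum is attained) also guarantees that the real
   infimum in the first one is that of a nonempty set bounded below. *)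
Definition HJB_solution : Prop :=
  [/\ forall z, time_state z ->
        Vt z + inf [set L z u + dotv (gV z) (f z u) | u in U] = 0,
      forall z, time_state z ->
        argmin U (fun u => L z u + dotv (gV z) (f z u)) !=set0 &
      forall x, X x -> V (T, x) = M x].

Definition Hstar (z : R * 'cV[R]_d) (u : 'cV[R]_p) : R :=
  Vt z + L z u + dotv (gV z) (f z u).

Definition Omega2 : set 'cV[R]_p := U°.

Definition Omega1 : set (R * 'cV[R]_d) :=
  [set z | time_state z /\ argmin U (Hstar z) `<=` Omega2]°.

Definition Omega : set (R * 'cV[R]_d * 'cV[R]_p) := Omega1 `*` Omega2.

End OptimalControl.

(* Main.v *)
From HB Require Import structures.
Require Import Defs.
From mathcomp Require Import ring lra.

(* On Omega_1 the minimizer us z of H*(z, .) lies in Int U, so the gradient of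
   H*(z, .) vanishes there. By strong convexity this zero is unique and depends
   on z in a locally Lipschitz way, hence it is differentiable and, by
   bootstrapping the formula for its derivative, C^s. Since H*(z, us z) = 0,
   Taylor's formula with integral remainder reads
     H*(z, u) = (u - us z)^T Q(z, u) (u - us z),
     Q(z, u) = int_0^1 (1 - t) hess L (us z + t (u - us z)) dt,
   where Q is C^s and positive definite. The Cholesky factorization Q = W^T W
   only involves square roots and quotients of positive C^s functions, so W is
   C^s and the w_j are the coordinates of W (u - us z). *)

Set Implicit Arguments.
Unset Strict Implicit.
Unset Printing Implicit Defensive.

Local Open Scope classical_set_scope.
Local Open Scope ring_scope.

(** [Hstar] itself is not known to be regular: neither [L] nor [gV] alone is assumed C^s in z, only
    the gradient of [Hstar] in u and the Hessian of [L] are. All regularity therefore goes through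
    these two maps. The obstacle is that [us] is chosen pointwise, with no continuity, and that the
    convexity constant depends on z, so that a priori the minimizer could jump. An implicit function
    theorem would give a local branch of zeros, still to be identified with [us]. Instead the
    differential of the given [us] is computed directly from a Lipschitz estimate, which rests on
    monotonicity along segments; these stay in Int U because U is convex. *)

Lemma open_setX (S T : topologicalType) (A : set S) (B : set T) :
  open A -> open B -> open (A `*` B).
Proof.
move=> oA oB; rewrite openE => -[x y] [/= Ax By].
by exists (A, B) => //=; split; apply: open_nbhs_nbhs.
Qed.

(** * Calculus of functions of class Ck *)

Section Differentiability.
Context {R : realType} {E : normedModType R}.
Implicit Types (h : E -> R) (x v : E) (l : {linear E -> R}).

Lemma differentiable_near_le h x : differentiable h x -> forall e : R, 0 < e ->
  \forall y \near x, `|h y - h x - 'd h x (y - x)| <= e * `|y - x|.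
Proof.
move=> /diff_locallyP[_ /eqaddoP hx] e e0.
have /nbhs_ballP[r /= r0 xr] := hx e e0.
apply/nbhs_ballP; exists r => // y; rewrite -ball_normE /= => yr.
have := xr (y - x); rewrite -ball_normE /= sub0r opprB => /(_ yr).
by rewrite !fctE /= subrK opprD addrA.
Qed.

(** Uniqueness of the differential identifies [l] with it. This serves whenever the differential is
    an explicit candidate: for integrals with a parameter and for the minimizer. *)
Lemma near_le_differentiable h x l : continuous l ->
  (forall e : R, 0 < e ->
    \forall y \near x, `|h y - h x - l (y - x)| <= e * `|y - x|) ->
  differentiable h x /\ forall v, 'D_v h x = l v.
Proof.
move=> cl hl.
have hx : h \o shift x = cst (h x) + l +o_ 0 id.
  apply/eqaddoP => e e0; have /nbhs_ballP[r /= r0 xr] := hl e e0.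
  apply/nbhs_ballP; exists r => // y; rewrite -ball_normE /= sub0r normrN => yr.
  have := xr (y + x); rewrite -ball_normE /= opprD addrCA subrr addr0 normrN.
  by move=> /(_ yr); rewrite !fctE /= addrK opprD addrA.
have dl := diff_unique cl hx.
have dh : differentiable h x by apply/diff_locallyP; rewrite dl.
by split => // v; rewrite deriveE// dl.
Qed.

Lemma near_eq_differentiable h h' x : {near x, h =1 h'} ->
  differentiable h x -> differentiable h' x.
Proof.
move=> hh' dh; have hx := nbhs_singleton hh'.
apply: (@near_le_differentiable _ _ ('d h x) _ _).1; first exact: diff_continuous.
move=> e e0; apply: filterS2 hh' (differentiable_near_le dh e0) => y hy.
by rewrite hy hx.
Qed.

End Differentiability.

Section Ck.
Context {R : realType} {E : normedModType R}.
Implicit Types (D : set E) (h : E -> R) (k : nat).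

(** As [D] is open, equality on [D] is equality near each of its points, hence passes to
    derivatives. It lets a derivative be replaced by a formula valid on [D] only. *)
Lemma eq_Ck k D h h' : open D -> {in D, h =1 h'} -> Ck k D h -> Ck k D h'.
Proof.
move=> oD; elim: k h h' => [|k IH] h h' hh' /=.
- move=> ch x Dx; have xhh' : {near x, h =1 h'}.
    by apply: filterS (open_nbhs_nbhs (conj oD Dx)) => y /mem_set /hh'.
  rewrite /prop_for /continuous_at -(hh' x) ?inE//.
  by apply: cvg_trans (ch x Dx); apply: near_eq_cvg.
- have near_hh' x : D x -> {near x, h =1 h'}.
    by move=> Dx; apply: filterS (open_nbhs_nbhs (conj oD Dx)) => y /mem_set/hh'.
  move=> [dh Dh]; split=> [x Dx|v].
    exact: near_eq_differentiable (near_hh' x Dx) (dh x Dx).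
  apply: IH (Dh v) => x /set_mem /near_hh'; exact: near_eq_derive.
Qed.

Lemma Ck_subset k D D' h : D' `<=` D -> Ck k D h -> Ck k D' h.
Proof.
move=> D'D; elim: k h => [|k IH] h /=; first by move=> ch x /D'D /ch.
by move=> [dh Dh]; split=> [x /D'D /dh//|v]; apply: IH (Dh v).
Qed.

Lemma CkW k D h : Ck k.+1 D h -> Ck k D h.
Proof.
elim: k h => [|k IH] h /= [dh Dh]; last by split=> // v; apply: IH (Dh v).
by move=> x /dh /differentiable_continuous.
Qed.

Lemma Ck_leq k k' D h : (k <= k')%N -> Ck k' D h -> Ck k D h.
Proof.
move=> /subnKC <-; elim: (k' - k)%N => [|n IH]; first by rewrite addn0.
by rewrite addnS => /CkW.
Qed.

Lemma Ck_continuous k D h x : Ck k D h -> D x -> {for x, continuous h}.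
Proof. by elim: k => [|k IH]; [apply|move/CkW/IH]. Qed.

Lemma Ck_cst k D (c : R) : Ck k D (cst c).
Proof.
elim: k c => [|k IH] c /=; first by move=> x _; apply: cst_continuous.
split=> // v; rewrite (_ : 'D_v (cst c) = cst 0)//.
by apply/funext => x; rewrite derive_cst.
Qed.

Lemma CkD k D h h' : open D -> Ck k D h -> Ck k D h' ->
  Ck k D (fun x => h x + h' x).
Proof.
move=> oD; elim: k h h' => [|k IH] h h' /=.
  by move=> ch ch' x Dx; apply: cvgD; [apply: ch|apply: ch'].
move=> [dh Dh] [dh' Dh']; split=> [x Dx|v].
  by apply: differentiableD; [apply: dh|apply: dh'].
apply: eq_Ck (IH _ _ (Dh v) (Dh' v)) => // x /set_mem Dx.
by rewrite deriveD//; apply: diff_derivable; [apply: dh|apply: dh'].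
Qed.

Lemma CkM k D h h' : open D -> Ck k D h -> Ck k D h' ->
  Ck k D (fun x => h x * h' x).
Proof.
move=> oD; elim: k h h' => [|k IH] h h' /=.
  by move=> ch ch' x Dx; apply: cvgM; [apply: ch|apply: ch'].
move=> Ch Ch'; have [dh Dh] := Ch; have [dh' Dh'] := Ch'.
split=> [x Dx|v].
  by apply: differentiableM; [apply: dh|apply: dh'].
apply: eq_Ck (CkD oD (IH _ _ (CkW Ch) (Dh' v)) (IH _ _ (CkW Ch') (Dh v))) => //.
move=> x /set_mem Dx.
by rewrite deriveM//; apply: diff_derivable; [apply: dh|apply: dh'].
Qed.

Lemma CkN k D h : open D -> Ck k D h -> Ck k D (fun x => - h x).
Proof.
move=> oD Ch; apply: eq_Ck (CkM oD (Ck_cst k D (- 1)) Ch) => // x _.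
by rewrite mulN1r.
Qed.

Lemma CkB k D h h' : open D -> Ck k D h -> Ck k D h' ->
  Ck k D (fun x => h x - h' x).
Proof. by move=> oD Ch Ch'; apply: CkD => //; apply: CkN. Qed.

Lemma Ck_sum (I : Type) (r : seq I) (P : pred I) k D (h : I -> E -> R) :
  open D -> (forall i, Ck k D (h i)) ->
  Ck k D (fun x => \sum_(i <- r | P i) h i x).
Proof.
move=> oD Ch; elim: r => [|i r IH].
  by apply: eq_Ck (Ck_cst k D 0) => // x _; rewrite big_nil.
case Pi: (P i).
  by apply: eq_Ck (CkD oD (Ch i) IH) => // x _; rewrite big_cons Pi.
by apply: eq_Ck IH => // x _; rewrite big_cons Pi.
Qed.

Lemma Ck_prod (I : Type) (r : seq I) (P : pred I) k D (h : I -> E -> R) :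
  open D -> (forall i, Ck k D (h i)) ->
  Ck k D (fun x => \prod_(i <- r | P i) h i x).
Proof.
move=> oD Ch; elim: r => [|i r IH].
  by apply: eq_Ck (Ck_cst k D 1) => // x _; rewrite big_nil.
case Pi: (P i).
  by apply: eq_Ck (CkM oD (Ch i) IH) => // x _; rewrite big_cons Pi.
by apply: eq_Ck IH => // x _; rewrite big_cons Pi.
Qed.

(** The derivative [- h^-2 * 'D_v h] contains the inverse again, but one order lower, where the
    induction hypothesis for the same [h] applies. [Ck_sqrt] follows the same pattern. *)
Lemma CkV k D h : open D -> (forall x, D x -> h x != 0) -> Ck k D h ->
  Ck k D (fun x => (h x)^-1).
Proof.
move=> oD h0; elim: k => [|k IH] /=.
  by move=> ch x Dx; apply: cvgV (ch x Dx); exact: h0.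
move=> Ch; have [dh Dh] := Ch; have CV := IH (CkW Ch).
split=> [x Dx|v].
  by apply: differentiableV; [exact: dh|exact: h0].
apply: eq_Ck (CkN oD (CkM oD (CkM oD CV CV) (Dh v))) => // x /set_mem Dx.
rewrite deriveV ?h0//; last exact/diff_derivable/dh.
by rewrite -[RHS]/(- (h x) ^- 2 * _) -exprVn expr2 mulNr.
Qed.

Lemma Ck_sqrt k D h : open D -> (forall x, D x -> 0 < h x) -> Ck k D h ->
  Ck k D (fun x => Num.sqrt (h x)).
Proof.
move=> oD h0; elim: k => [|k IH].
  move=> ch x Dx; apply: continuous_comp; first exact: (ch x Dx).
  exact: sqrt_continuous.
move=> Ch; have [dh Dh] := Ch.
have dsqrt x : D x -> differentiable Num.sqrt (h x).
  move=> /h0 hx; apply/derivable1_diffP.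
  by have [] := is_derive1_sqrt hx.
split=> [x Dx|v].
  exact: differentiable_comp (dh x Dx) (dsqrt x Dx).
have Csq : Ck k D (fun x => (2 * Num.sqrt (h x))^-1).
  apply: CkV => //.
    by move=> x /h0 hx; rewrite mulf_neq0 ?gt_eqF// sqrtr_gt0.
  by apply: CkM => //; [exact: Ck_cst|exact/IH/CkW].
apply: eq_Ck (CkM oD (Dh v) Csq) => // x /set_mem Dx.
have dx := dh x Dx; have dsx := dsqrt x Dx.
rewrite [RHS]deriveE; last exact: (differentiable_comp dx dsx).
rewrite diff_comp//= -(derive_sqrt (h0 x Dx)) deriveE// deriveE//.
(* A differential on [R] is multiplication by its value at 1, so ['d h x v] comes out as a
   scalar. *)
by rewrite -[in RHS](mulr1 ('d h x v)) [RHS]linearZ.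
Qed.

End Ck.

(* Ck only speaks of scalar functions: vector-valued maps are handled through
   their coordinates in a finite basis. *)
Record frame (R : realType) (E : normedModType R) := Frame {
  fidx : finType;
  fvec : fidx -> E;
  fcrd : fidx -> {linear E -> R};
  fcrd_continuous : forall i, continuous (fcrd i);
  frameE : forall v, v = \sum_i fcrd i v *: fvec i
}.

Section FrameInstances.
Context {R : realType}.

(** The frames are transparent: later proofs compute [fidx] and [fcrd], for instance to split an
    index of a product frame into cases. *)
Definition frameR : frame R.
Proof.
refine (@Frame R R unit (fun=> 1) (fun=> idfun) _ _).
  by move=> _ x; exact: cvg_id.
by move=> v; rewrite big_const card_unit /= addr0 [LHS](esym (mulr1 v)).
Defined.

(** Named so that the coordinate map can carry the linear structure that [fcrd] requires. *)
Definition mxcoord m n (i : 'I_m) (j : 'I_n) (N : 'M[R]_(m, n)) : R := N i j.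

Fact mxcoord_linear m n (i : 'I_m) (j : 'I_n) : linear (mxcoord i j).
Proof. by move=> a u v; rewrite /mxcoord !mxE. Qed.

HB.instance Definition _ m n (i : 'I_m) (j : 'I_n) :=
  GRing.isLinear.Build R _ _ _ (mxcoord i j) (mxcoord_linear i j).

Definition frame_cV n : frame 'cV[R]_n.
Proof.
refine (@Frame R _ 'I_n (fun i => delta_mx i ord0)
  (fun i => mxcoord i ord0) _ _).
  by move=> i; exact: coord_continuous.
move=> v; apply/colP => i; rewrite summxE (bigD1 i)//= big1.
  by rewrite !mxE eqxx mulr1 addr0.
by move=> j ji; rewrite !mxE eq_sym (negPf ji) mulr0.
Defined.

Context {E F : normedModType R}.
Variables (bE : frame E) (bF : frame F).

Definition frame_prod : frame (E * F)%type.
Proof.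
refine (@Frame R _ (fidx bE + fidx bF)%type
  (fun i => match i with inl i => (fvec i, 0) | inr j => (0, fvec j) end)
  (fun i => match i with inl i => fcrd i \o fst | inr j => fcrd j \o snd end)
  _ _).
  move=> [i|j] x.
    by apply: continuous_comp; [exact: cvg_fst|exact: fcrd_continuous].
  by apply: continuous_comp; [exact: cvg_snd|exact: fcrd_continuous].
move=> [u v]; rewrite big_sumType/= {1}(frameE bE u) {1}(frameE bF v).
apply: injective_projections; rewrite /= !raddf_sum/=.
  by rewrite [X in _ + X]big1 ?addr0// => j _; rewrite scaler0.
by rewrite [X in X + _]big1 ?add0r// => j _; rewrite scaler0.
Defined.

End FrameInstances.

(** * Chain rule and composition of C^k maps *)

Section CkComp.
Context {R : realType}.

Lemma Ck_linear (E : normedModType R) k (D : set E) (l : {linear E -> R}) :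
  continuous l -> Ck k D l.
Proof.
move=> cl; case: k => [|k]; first by move=> x _; exact: cl.
split=> [x _|v]; first exact: linear_differentiable.
rewrite (_ : 'D_v l = cst (l v)); first exact: Ck_cst.
apply/funext => x; rewrite deriveE; last exact: linear_differentiable.
by rewrite diff_lin.
Qed.

Context {E F : normedModType R} (bF : frame F).

Lemma frame_continuous (phi : E -> F) x :
  (forall i : fidx bF, {for x, continuous (fun y => fcrd i (phi y))}) ->
  {for x, continuous phi}.
Proof.
move=> cphi.
rewrite (_ : phi = fun y => \sum_(i : fidx bF) fcrd i (phi y) *: fvec i);
  last by apply/funext => y; exact: (frameE bF).
rewrite /prop_for /continuous_at; elim: (index_enum _) => [|i r IH].
  by rewrite big_nil; under eq_fun do rewrite big_nil; exact: cvg_cst.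
rewrite big_cons; under eq_fun do rewrite big_cons.
by apply: cvgD => //; apply: cvgZr_tmp; exact: cphi.
Qed.

Lemma frame_differentiable (phi : E -> F) x :
  (forall i : fidx bF, differentiable (fun y => fcrd i (phi y)) x) ->
  differentiable phi x.
Proof.
move=> dphi.
rewrite (_ : phi = fun y => \sum_(i : fidx bF) fcrd i (phi y) *: fvec i);
  last by apply/funext => y; exact: (frameE bF).
elim: (index_enum _) => [|i r IH].
  under eq_fun do rewrite big_nil; exact: differentiable_cst.
under eq_fun do rewrite big_cons.
by apply: differentiableD => //; apply: differentiableZl; exact: dphi.
Qed.

Lemma derive_frame (h : F -> R) x v : differentiable h x ->
  'D_v h x = \sum_(i : fidx bF) fcrd i v * 'D_(fvec i) h x.
Proof.
move=> dh; rewrite deriveE// {1}(frameE bF v) linear_sum.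
by apply: eq_bigr => i _; rewrite linearZ deriveE.
Qed.

Lemma derive_pairr (h : E * F -> R) w v : differentiable h w ->
  'D_(0, v) h w = \sum_(i : fidx bF) fcrd i v * 'D_(0, fvec i) h w.
Proof.
move=> dh; rewrite deriveE// {1}(frameE bF v).
rewrite (_ : (0, _) = \sum_(i : fidx bF) fcrd i v *: ((0 : E), fvec i)).
  by rewrite linear_sum; apply: eq_bigr => i _; rewrite linearZ deriveE.
apply: injective_projections; rewrite /= !raddf_sum//= big1// => i _.
by rewrite scaler0.
Qed.

Lemma derive_comp_frame (h : F -> R) (phi : E -> F) x v :
  differentiable h (phi x) -> differentiable phi x ->
  'D_v (h \o phi) x =
  \sum_(i : fidx bF) 'D_(fvec i) h (phi x) * 'D_v (fun y => fcrd i (phi y)) x.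
Proof.
move=> dh dphi; rewrite deriveE; last exact: differentiable_comp.
rewrite diff_comp//= [in LHS](frameE bF ('d phi x v)) linear_sum.
apply: eq_bigr => i _; rewrite deriveE// linearZ mulrC; congr (_ * _).
have dl : differentiable (fcrd i) (phi x).
  exact/linear_differentiable/fcrd_continuous.
rewrite deriveE; last exact: (differentiable_comp dphi dl).
by rewrite [in RHS]diff_comp//= diff_lin//; exact: fcrd_continuous.
Qed.

(** The chain rule gives a sum of products of ['D_(fvec i) h \o phi], covered by the induction
    hypothesis for another [h], and derivatives of the coordinates of [phi]. *)
Lemma Ck_comp k (D : set E) (D' : set F) (h : F -> R) (phi : E -> F) :
  open D -> (forall x, D x -> D' (phi x)) ->
  (forall i : fidx bF, Ck k D (fun x => fcrd i (phi x))) ->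
  Ck k D' h -> Ck k D (h \o phi).
Proof.
move=> oD DD'; elim: k h => [|k IH] h Cphi.
  move=> ch x Dx; apply: continuous_comp (ch _ (DD' _ Dx)).
  by apply: frame_continuous => i; exact: Cphi.
move=> [dh Dh].
have dphi x : D x -> differentiable phi x.
  by move=> Dx; apply: frame_differentiable => i; exact: (Cphi i).1.
split=> [x Dx|v].
  by apply: differentiable_comp; [exact: dphi|exact/dh/DD'].
have Cs : Ck k D (fun x => \sum_(i : fidx bF)
    ('D_(fvec i) h \o phi) x * 'D_v (fun y => fcrd i (phi y)) x).
  apply: Ck_sum => // i; apply: CkM => //; last exact: (Cphi i).2.
  by apply: IH (Dh _) => j; exact/CkW/Cphi.
apply: eq_Ck Cs => // x /set_mem Dx.
by rewrite derive_comp_frame//; [exact/dh/DD'|exact: dphi].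
Qed.

End CkComp.

Lemma is_derive_line (R : realType) (E F : normedModType R) (h : E -> F)
    (a w : E) (s : R) :
  derivable h (a + s *: w) w ->
  is_derive s 1 (fun r => h (a + r *: w)) ('D_w h (a + s *: w)).
Proof.
have eqf : (fun k : R => k^-1 *: (((fun r => h (a + r *: w)) \o shift s) (k *: 1)
      - h (a + s *: w))) =
    (fun k : R => k^-1 *: ((h \o shift (a + s *: w)) (k *: w) - h (a + s *: w))).
  apply/funext => k /=; congr (_ *: (h _ - _)).
  by rewrite [k *: 1]mulr1 scalerDl addrCA.
move=> dh; apply: DeriveDef; first by rewrite /derivable eqf.
by rewrite /derive eqf.
Qed.

(** * Integrals over [0, 1] depending on a parameter *)

Section UnitIntegral.
Context {R : realType}.
Local Notation mu := (@lebesgue_measure R).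
Implicit Types f : R -> R.

Lemma continuous_integrable01 f : {within `[0, 1], continuous f} ->
  mu.-integrable `[0, 1] (EFin \o f).
Proof. by apply: continuous_compact_integrable; exact: segment_compact. Qed.

Lemma int01_cst (c : R) : \int[mu]_(t in `[0, 1]) c = c.
Proof.
rewrite Rintegral_cst//= lebesgue_measure_itv /= lte_fin ltr01.
by rewrite oppr0 adde0 /= mulr1.
Qed.

Lemma le_int01 f f' : {within `[0, 1], continuous f} ->
  {within `[0, 1], continuous f'} ->
  (forall t : R, 0 <= t <= 1 -> f t <= f' t) ->
  \int[mu]_(t in `[0, 1]) f t <= \int[mu]_(t in `[0, 1]) f' t.
Proof.
move=> cf cf' ff'; apply: le_Rintegral => //; try exact: continuous_integrable01.
Qed.

Lemma normr_int01_le f (e : R) : {within `[0, 1], continuous f} ->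
  (forall t : R, 0 <= t <= 1 -> `|f t| <= e) ->
  `|\int[mu]_(t in `[0, 1]) f t| <= e.
Proof.
move=> cf fe; rewrite ler_norml -{1}(int01_cst (- e)) -{2}(int01_cst e).
have cc (c : R) : {within `[0, 1], continuous (fun _ : R => c)}.
  by apply: continuous_subspaceT => ?; exact: cvg_cst.
by apply/andP; split; apply: le_int01 => // t /fe; rewrite ler_norml => /andP[].
Qed.

(** Continuity and value are proved together because splitting off one term of the integral requires
    the tail to be integrable. *)
Lemma int01_sum (I : Type) (r : seq I) (F : I -> R -> R) (c : I -> R) :
  (forall i, {within `[0, 1], continuous (F i)}) ->
  {within `[0, 1], continuous (fun t => \sum_(i <- r) c i * F i t)} /\
  \int[mu]_(t in `[0, 1]) (\sum_(i <- r) c i * F i t) =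
  \sum_(i <- r) c i * \int[mu]_(t in `[0, 1]) F i t.
Proof.
move=> cF; elim: r => [|i r [IHc IH]].
  rewrite (_ : (fun t => _) = fun=> 0); last first.
    by apply/funext => t; rewrite big_nil.
  rewrite big_nil int01_cst; split=> //.
  by apply: continuous_subspaceT => ?; exact: cvg_cst.
have ci : {within `[0, 1], continuous (fun t => c i * F i t)}.
  by move=> t; apply: cvgM; [exact: cvg_cst|exact: cF].
rewrite (_ : (fun t => _) =
    fun t => c i * F i t + \sum_(i <- r) c i * F i t); last first.
  by apply/funext => t; rewrite big_cons.
rewrite big_cons; split.
  by move=> t; apply: cvgD; [exact: ci|exact: IHc].
rewrite RintegralD//; try exact: continuous_integrable01.
by rewrite IH RintegralZl//; exact: continuous_integrable01.
Qed.

End UnitIntegral.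

Section ParameterIntegral.
Context {R : realType} {E : normedModType R} (bE : frame E).
Local Notation mu := (@lebesgue_measure R).
Implicit Types (h : R * E -> R) (x : E).

Lemma within01_slice h x :
  (forall t : R, 0 <= t <= 1 -> {for (t, x), continuous h}) ->
  {within `[0, 1], continuous (fun t => h (t, x))}.
Proof.
move=> ch; apply: continuous_in_subspaceT => t /set_mem /=.
rewrite in_itv /= => /ch cht.
apply: (@continuous_comp _ _ _ (fun t : R => (t, x)) h t) => //.
exact: (@cvg_pair R R E (nbhs t) (nbhs t) (nbhs x) _ _ _ id (cst x)
  (@cvg_id _ _) (cvg_cst _)).
Qed.

(** A tube lemma: by compactness of [0, 1], continuity at the points of the segment over [x] becomes
    uniform in t. Near each t0 both values are compared with [h (t0, x)]. *)
Lemma near_uniform01 h x (e : R) : 0 < e ->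
  (forall t : R, 0 <= t <= 1 -> {for (t, x), continuous h}) ->
  \forall y \near x, forall t : R, 0 <= t <= 1 -> `|h (t, y) - h (t, x)| <= e.
Proof.
move=> e0 ch.
pose P y t := `|h (t, y) - h (t, x)| <= e.
have cover : \forall y \near x, `[0, 1]%classic `<=` P y.
  have /compact_near_coveringP c01 := @segment_compact R 0 1.
  apply: (c01 E (nbhs x) P _) => t0 /=; rewrite in_itv /= => t01.
  have e20 : 0 < e / 2 by rewrite divr_gt0.
  have /cvgrPdist_lt/(_ _ e20) [[A B] /= [At Bx] AB] := ch t0 t01.
  exists (A, B) => // -[t y] /= [At' By'].
  have := AB (t, y) (conj At' By').
  have := AB (t, x) (conj At' (nbhs_singleton Bx)).
  rewrite /P /=; set a := h (t0, x); set b := h (t, x); set c := h (t, y).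
  move=> ab ac; have := ler_distD a c b; rewrite (distrC c a).
  move=> /le_trans -> //; rewrite [leRHS]splitr.
  by rewrite lerD ?ltW.
by apply: filterS cover => y Py t t01; apply: Py; rewrite /= in_itv.
Qed.

(** Continuity is asked over a neighbourhood of [x] so that the slices at nearby points are
    integrable too. *)
Lemma int01_continuous h x :
  (\forall y \near x, forall t : R, 0 <= t <= 1 -> {for (t, y), continuous h}) ->
  {for x, continuous (fun y => \int[mu]_(t in `[0, 1]) h (t, y))}.
Proof.
move=> ch; apply/cvgrPdist_le => e e0.
have chx := nbhs_singleton ch.
apply: filterS2 ch (near_uniform01 e0 chx) => y chy hy.
rewrite distrC -RintegralB//; try exact/continuous_integrable01/within01_slice.
apply: normr_int01_le => // t.
by apply: cvgB; exact: within01_slice.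
Qed.

(** Differentiation under the integral sign. The partial derivatives along the frame vary little
    near [x], uniformly in t, and the mean value theorem turns this into a bound on the integrand of
    the error. *)
Lemma int01_differentiable (D : set E) (D' : set (R * E)) h : open D ->
  (forall (t : R) x, 0 <= t <= 1 -> D x -> D' (t, x)) -> Ck 1 D' h ->
  forall x, D x ->
    differentiable (fun y => \int[mu]_(t in `[0, 1]) h (t, y)) x /\
    forall v, 'D_v (fun y => \int[mu]_(t in `[0, 1]) h (t, y)) x =
      \int[mu]_(t in `[0, 1]) 'D_(0, v) h (t, x).
Proof.
move=> oD DD' [dh Dh] x Dx.
pose Dvec (i : fidx bE) (w : R * E) : R := 'D_(0 : R, fvec i) h w.
have cDvec i y (t : R) : D y -> 0 <= t <= 1 -> {for (t, y), continuous (Dvec i)}.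
  by move=> Dy t01; apply: (Dh (0, fvec i) (t, y)); exact: DD'.
have ch y (t : R) : D y -> 0 <= t <= 1 -> {for (t, y), continuous h}.
  by move=> Dy t01; apply/differentiable_continuous/dh/DD'.
have Dexp (t : R) y v : D y -> 0 <= t <= 1 ->
    'D_(0, v) h (t, y) = \sum_(i : fidx bE) fcrd i v * Dvec i (t, y).
  by move=> Dy t01; apply/derive_pairr/dh/DD'.
have cDx i : {within `[0, 1], continuous (fun t => Dvec i (t, x))}.
  by apply: within01_slice => t; exact: cDvec.
(* The candidate differential is written on the frame, so that linearity and continuity are
   inherited from the coordinates. *)
pose l v := \sum_(i : fidx bE) fcrd i v * \int[mu]_(t in `[0, 1]) Dvec i (t, x).
have l_lin : linear l.
  move=> a u v; rewrite /l scaler_sumr -big_split; apply: eq_bigr => i _ /=.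
  by rewrite linearP mulrDl scalerAl.
pose lM := GRing.isLinear.Build _ _ _ _ _ l_lin.
pose L : {linear E -> R} := HB.pack l lM.
have Lint v : L v = \int[mu]_(t in `[0, 1]) 'D_(0, v) h (t, x).
  rewrite /L /= /l -(int01_sum _ _ cDx).2; apply: eq_Rintegral => t.
  by rewrite inE /= in_itv /= => t01; rewrite Dexp.
have cL : continuous L.
  move=> v; rewrite /continuous_at /= /l.
  elim: (index_enum _) => [|i r IH].
    by rewrite big_nil; under eq_fun do rewrite big_nil; exact: cvg_cst.
  rewrite big_cons; under eq_fun do rewrite big_cons.
  by apply: cvgD => //; apply: cvgM; [exact: fcrd_continuous|exact: cvg_cst].
clearbody L; suff main (e : R) : 0 < e -> \forall y \near x,
    `|\int[mu]_(t in `[0, 1]) h (t, y) - \int[mu]_(t in `[0, 1]) h (t, x)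
      - L (y - x)| <= e * `|y - x|.
  have [dF DF] := near_le_differentiable cL main.
  by split=> // v; rewrite DF Lint.
move=> e0.
(* The sum of absolute coordinates is at most [K] times the norm; a variation [e / K] of each
   partial derivative then costs [e * |y - x|] in total. *)
have [K K0 hK] : exists2 K : R, 0 < K &
    forall v, \sum_(i : fidx bE) `|fcrd i v| <= K * `|v|.
  elim: (index_enum _) => [|i r [K K0 IH]].
    by exists 1 => // v; rewrite big_nil mul1r.
  have [k k0 hk] := linear_lipschitz (@fcrd_continuous _ _ bE i).
  exists (k + K); first by rewrite addr_gt0.
  by move=> v; rewrite big_cons mulrDl lerD.
have eK0 : 0 < e / K by rewrite divr_gt0.
have : \forall y \near x, D y /\ forall i : fidx bE, forall t : R,
    0 <= t <= 1 -> `|Dvec i (t, y) - Dvec i (t, x)| <= e / K.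
  apply: filterI; first exact: open_nbhs_nbhs.
  by apply: filter_forall => i; apply: near_uniform01 => // t; exact: cDvec.
move=> /nbhs_ballP[r /= r0 hr]; apply/nbhs_ballP; exists r => // y xyr.
have seg (s : R) : 0 <= s <= 1 -> ball x r (x + s *: (y - x)).
  move=> /andP[s0 s1]; move: xyr; rewrite -!ball_normE /=.
  rewrite opprD addrA subrr sub0r normrN normrZ distrC ger0_norm//.
  by apply: le_lt_trans; rewrite ler_piMl.
have Dy : D y by have [] := hr _ xyr.
have ch01 z : D z -> {within `[0, 1], continuous (fun t => h (t, z))}.
  by move=> Dz; apply: within01_slice => t; exact: ch.
have cD01 : {within `[0, 1], continuous (fun t => 'D_(0, y - x) h (t, x))}.
  apply: (@within01_slice ('D_(0, y - x) h)) => t t01.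
  by apply: (Dh (0, y - x) (t, x)); exact: DD'.
have cB : {within `[0, 1], continuous (fun t => h (t, y) - h (t, x))}.
  by move=> t; apply: cvgB; [exact: (ch01 _ Dy)|exact: (ch01 _ Dx)].
rewrite /= Lint -RintegralB//; try by apply: continuous_integrable01; exact: ch01.
rewrite -RintegralB//; try exact: continuous_integrable01.
apply: normr_int01_le => [t|t t01]; first by apply: cvgB; [exact: cB|exact: cD01].
have Dseg (s : R) : s \in `[0, 1] -> D (x + s *: (y - x)).
  by rewrite in_itv /= => /seg /hr[].
(* With t frozen, [gam] follows [h (t, .)] from [x] to [y]; the mean value theorem replaces the
   increment by a derivative at a point of that segment. *)
pose gam (s : R) : R := h ((t, x) + s *: ((0 : R), y - x)).
have gamE s : (t, x) + s *: ((0 : R), y - x) = (t, x + s *: (y - x)).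
  by apply: injective_projections; rewrite /= ?scaler0 ?addr0.
have dgam (s : R) : s \in `[0, 1] ->
    is_derive s 1 gam ('D_(0, y - x) h (t, x + s *: (y - x))).
  move=> s01; rewrite -gamE; apply: is_derive_line.
  by apply/diff_derivable/dh; rewrite gamE; apply: DD' => //; exact: Dseg.
have cgam : {within `[0, 1], continuous gam}.
  apply: continuous_in_subspaceT => s /set_mem s01.
  by apply/differentiable_continuous/derivable1_diffP; have [] := dgam s s01.
pose dg (s : R) : R := 'D_(0, y - x) h (t, x + s *: (y - x)).
have dgE (s : R) : s \in `]0, 1[ -> is_derive s 1 gam (dg s).
  by move=> s01; apply: dgam; apply: subset_itv_oo_cc.
have [s s01 hs] := MVT ltr01 dgE cgam.
move: hs; rewrite /dg /gam !gamE scale0r addr0 scale1r subrKC subr0 mulr1 => ->.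
have s01' : 0 <= s <= 1 by move: (subset_itv_oo_cc s01); rewrite in_itv.
have [Ds hDs] := hr _ (seg s s01').
rewrite !Dexp// -sumrB.
apply: (le_trans (ler_norm_sum _ _ _)).
apply: (@le_trans _ _ (\sum_(i : fidx bE) `|fcrd i (y - x)| * (e / K))).
  by apply: ler_sum => i _; rewrite -mulrBr normrM ler_wpM2l// hDs.
by rewrite -mulr_suml mulrA ler_pdivrMr// mulrC -mulrA ler_pM2l// [leRHS]mulrC.
Qed.

(** Each derivative is again an integral of the same kind, with ['D_(0, v) h] in place of [h], hence
    the induction with [h] general. *)
Lemma Ck_int01 k (D : set E) (D' : set (R * E)) h : open D -> 
  (forall (t : R) x, 0 <= t <= 1 -> D x -> D' (t, x)) -> Ck k D' h ->
  Ck k D (fun x => \int[mu]_(t in `[0, 1]) h (t, x)).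
Proof.
move=> oD DD'; elim: k h => [|k IH] h Ch.
  move=> x Dx; apply: int01_continuous.
  apply: filterS (open_nbhs_nbhs (conj oD Dx)) => y Dy t t01.
  by apply: Ch; exact: DD'.
have C1h : Ck 1 D' h by apply: Ck_leq Ch.
split=> [x Dx|v]; first exact: (int01_differentiable oD DD' C1h Dx).1.
apply: eq_Ck (IH _ (Ch.2 (0, v))) => // x /set_mem Dx.
by rewrite (int01_differentiable oD DD' C1h Dx).2.
Qed.

End ParameterIntegral.

(** * Smooth Cholesky factorization *)

Definition posdef (R : realType) n (A : 'M[R]_n) : Prop :=
  A^T = A /\ forall v : 'cV_n, v != 0 -> 0 < dotv v (A *m v).

(** A nonzero row v with v A = 0 would give 0 < v A v^T = 0. *)
Lemma coercive_unitmx (R : realType) n (A : 'M[R]_n) :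
  (forall v : 'cV_n, v != 0 -> 0 < dotv v (A *m v)) -> A \in unitmx.
Proof.
move=> A0; rewrite -row_free_unit -kermx_eq0; apply/negPn/negP => kA0.
have /rowV0Pn[v /sub_kermxP vA v0] := kA0.
have := A0 v^T; rewrite (can2_eq (@trmxK _ _ _) (@trmxK _ _ _)) trmx0 => /(_ v0).
by rewrite /dotv trmxK mulmxA vA mul0mx mxE ltxx.
Qed.

Section MatrixCk.
Context {R : realType} {E : normedModType R}.
Variables (k : nat) (D : set E).
Hypothesis oD : open D.

Lemma Ck_det n (A : E -> 'M[R]_n) : (forall i j, Ck k D (fun x => A x i j)) ->
  Ck k D (fun x => \det (A x)).
Proof.
move=> CA; apply: Ck_sum => // s; apply: CkM => //; first exact: Ck_cst.
by apply: Ck_prod.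
Qed.

(** Cramer's rule: an entry of the inverse is a cofactor divided by the determinant, which does not
    vanish on [D]. *)
Lemma Ck_invmx n (A : E -> 'M[R]_n) :
  (forall i j, Ck k D (fun x => A x i j)) ->
  (forall x, D x -> A x \in unitmx) ->
  forall i j, Ck k D (fun x => invmx (A x) i j).
Proof.
move=> CA uA i j.
have Cadj : Ck k D (fun x => (\det (A x))^-1 * (\adj (A x)) i j).
  apply: CkM => //.
    apply: CkV => //; last exact: Ck_det.
    by move=> x /uA; rewrite unitmxE unitfE.
  apply: eq_Ck (CkM oD (Ck_cst k D ((-1) ^+ (j + i)))
    (@Ck_det _ (fun x => row' j (col' i (A x))) _)) => //.
    by move=> x _; rewrite mxE.
  move=> i' j'; apply: eq_Ck (CA (lift j i') (lift i j')) => // x _.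
  by rewrite !mxE.
by apply: eq_Ck Cadj => // x /set_mem /uA Ax; rewrite /invmx Ax [RHS]mxE.
Qed.

(** One step of block elimination: with corner [a] and first row [b], the factor has first row (sqrt
    a, b / sqrt a), and below it a factor of the Schur complement [S], which is again positive
    definite and C^k. *)
Lemma Ck_cholesky n (A : E -> 'M[R]_n) :
  (forall i j, Ck k D (fun x => A x i j)) -> (forall x, D x -> posdef (A x)) ->
  exists W : E -> 'M[R]_n, (forall i j, Ck k D (fun x => W x i j)) /\
    forall x, D x -> (W x)^T *m W x = A x.
Proof.
elim: n A => [|n IH] A CA pA.
  by exists (fun=> 0); split=> [[]//|x Dx]; apply/matrixP => -[].
have {}CA : forall i j : 'I_(1 + n), Ck k D (fun x => A x i j) by exact: CA.
pose A' x : 'M[R]_(1 + n) := A x.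
pose a x := A x ord0 ord0.
pose b x := ursubmx (A' x); pose c x := dlsubmx (A' x).
have CE (i j : 'I_n.+1) F : (forall x, F x = A x i j) -> Ck k D F.
  by move=> FA; apply: eq_Ck (CA i j) => // x _; rewrite FA.
have A'E x : A' x = block_mx (a x)%:M (b x) (c x) (drsubmx (A' x)).
  rewrite -[LHS]submxK; congr block_mx.
  by rewrite [LHS]mx11_scalar !mxE; congr (A x _ _)%:M; apply: val_inj.
have cE x : D x -> c x = (b x)^T.
  by move=> /pA[As _]; rewrite /c /b trmx_ursub /A' As.
have a0 x : D x -> 0 < a x.
  (* The corner is the value of the quadratic form at the first basis vector. *)
  move=> /pA[_ /(_ (delta_mx ord0 ord0))]; set e := delta_mx _ _ => Ae.
  have : e != 0.
    apply/eqP => /matrixP/(_ ord0 ord0); rewrite !mxE => /eqP.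
    by rewrite oner_eq0.
  by move=> /Ae; rewrite /dotv trmx_delta -rowE -colE !mxE.
have Ca : Ck k D a by apply: (CE ord0 ord0).
have Cb j : Ck k D (fun x => b x ord0 j).
  by apply: (CE (lshift n (ord0 : 'I_1)) (rshift 1 j)) => x; rewrite !mxE.
pose S x := drsubmx (A' x) - (a x)^-1 *: ((b x)^T *m b x).
have CS i j : Ck k D (fun x => S x i j).
  have : Ck k D (fun x => A x (rshift 1 i) (rshift 1 j) -
      (a x)^-1 * (b x ord0 i * b x ord0 j)).
    apply: (CkB oD (CA _ _)); apply: (CkM oD _ (CkM oD (Cb i) (Cb j))).
    by apply: CkV => // x /a0 ax; rewrite gt_eqF.
  apply: eq_Ck => // x _; by rewrite /S !mxE big_ord1 !mxE.
have pS x : D x -> posdef (S x).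
  move=> Dx; have [As Ap] := pA x Dx; split.
    rewrite linearB linearZ /= trmx_mul trmxK; congr (_ - _).
    by rewrite trmx_drsub; congr drsubmx; rewrite /A' As.
  (* This [t] cancels the first coordinate of A (t, w), so the form of A at (t, w) equals the form
     of [S] at [w]. *)
  move=> w w0; pose t := - ((a x)^-1 *: (b x *m w)).
  have /Ap : col_mx t w != 0 by rewrite col_mx_eq0 negb_and w0 orbT.
  have Atw : A' x *m col_mx t w = col_mx 0 (S x *m w).
    rewrite [in LHS]A'E mul_block_col mul_scalar_mx scalerN scalerA.
    rewrite mulfV ?gt_eqF ?a0// scale1r addNr; congr col_mx.
    by rewrite /t cE// mulmxN -scalemxAr mulmxA addrC /S mulmxBl -scalemxAl.
  have -> : A x *m col_mx t w = col_mx (0 : 'cV_1) (S x *m w) by exact: Atw.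
  by rewrite /dotv (@tr_col_mx _ 1 n) (@mul_row_col _ _ 1 n) mulmx0 add0r.
have [W [CW WS]] := IH S CS pS.
exists (fun x => block_mx (Num.sqrt (a x))%:M
  ((Num.sqrt (a x))^-1 *: b x) 0 (W x) : 'M[R]_(1 + n)).
have Csq : Ck k D (fun x => Num.sqrt (a x)) by exact: Ck_sqrt.
have sq0 x : D x -> Num.sqrt (a x) != 0.
  by move=> /a0 ?; rewrite gt_eqF// sqrtr_gt0.
split=> [i j|x Dx].
  rewrite -(@splitK 1 n i) -(@splitK 1 n j).
  case: (@fintype.split 1 n i) => i'; case: (@fintype.split 1 n j) => j' /=.
  - apply: eq_Ck Csq => // x _.
    by rewrite (@block_mxEul _ 1 n 1 n) mxE !ord1 eqxx mulr1n.
  - apply: eq_Ck (CkM oD (CkV oD sq0 Csq) (Cb j')) => // x _.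
    by rewrite (@block_mxEur _ 1 n 1 n) [RHS]mxE (ord1 i').
  - apply: eq_Ck (Ck_cst k D 0) => // x _.
    by rewrite (@block_mxEdl _ 1 n 1 n) mxE.
  - by apply: eq_Ck (CW i' j') => // x _; rewrite (@block_mxEdr _ 1 n 1 n).
suff WA (Wx : 'M[R]_(1 + n)) :
    Wx = block_mx (Num.sqrt (a x))%:M ((Num.sqrt (a x))^-1 *: b x) 0 (W x) ->
    Wx^T *m Wx = A' x by exact: WA _ erefl.
move=> ->; rewrite tr_block_mx mulmx_block A'E.
rewrite !tr_scalar_mx trmx0 !mulmx0 !mul0mx !addr0.
have sqa : Num.sqrt (a x) * Num.sqrt (a x) = a x.
  by rewrite -expr2 sqr_sqrtr// ltW// a0.
congr block_mx.
- by rewrite -scalar_mxM sqa.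
- by rewrite mul_scalar_mx scalerA mulfV ?sq0// scale1r.
- by rewrite mul_mx_scalar linearZ /= scalerA mulfV ?sq0// scale1r cE.
- rewrite WS// -scalemxAr [(_ *: b x)^T]linearZ /= -scalemxAl scalerA -invfM.
  by rewrite sqa subrKC.
Qed.

End MatrixCk.

(** * Zeros of strongly monotone maps *)

Section ColumnVectors.
Context {R : realType} {p : nat}.
Implicit Types (a b v : 'cV[R]_p).

Lemma dotvE a b : dotv a b = \sum_i a i ord0 * b i ord0.
Proof. by rewrite /dotv mxE; apply: eq_bigr => i _; rewrite mxE. Qed.

Lemma dotvC a b : dotv a b = dotv b a.
Proof. by rewrite !dotvE; apply: eq_bigr => i _; rewrite mulrC. Qed.

Lemma dotvDr a b v : dotv a (b + v) = dotv a b + dotv a v.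
Proof. by rewrite /dotv mulmxDr mxE. Qed.

Lemma dotvZr a (r : R) v : dotv a (r *: v) = r * dotv a v.
Proof. by rewrite /dotv -scalemxAr mxE. Qed.

Lemma ler_coord_norm v i : `|v i ord0| <= `|v|.
Proof.
rewrite [leRHS]/Num.Def.normr/= mx_normrE.
exact: (le_bigmax _ (fun i : 'I_p * 'I_1 => `|v i.1 i.2|) (i, ord0)).
Qed.

Lemma norm_cV_le v (x : R) : 0 <= x -> (forall i, `|v i ord0| <= x) -> `|v| <= x.
Proof.
move=> x0 vx; rewrite /Num.Def.normr/= mx_normrE.
by apply: bigmax_le => //= -[i j] _ /=; rewrite (ord1 j).
Qed.

Lemma dotvv_ge0 v : 0 <= dotv v v.
Proof. by rewrite dotvE sumr_ge0// => i _; rewrite -expr2 sqr_ge0. Qed.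

(** The norm of a column is the sup norm, hence only an inequality here, and factors [p%:R] in the
    reverse bounds below. *)
Lemma sqr_norm_le_dotv v : `|v| ^+ 2 <= dotv v v.
Proof.
rewrite -[leRHS]sqr_sqrtr ?dotvv_ge0// ler_pXn2r// ?nnegrE ?sqrtr_ge0//.
apply: norm_cV_le => [|i]; first exact: sqrtr_ge0.
rewrite -sqrtr_sqr ler_wsqrtr// dotvE (bigD1 i)//= -expr2 lerDl.
by rewrite sumr_ge0// => j _; rewrite -expr2 sqr_ge0.
Qed.

Lemma dotv_gt0 v : v != 0 -> 0 < dotv v v.
Proof.
move=> v0; apply: lt_le_trans (sqr_norm_le_dotv v).
by rewrite exprn_gt0// normr_gt0.
Qed.

Lemma normr_mulmx_le (M : 'M[R]_p) (e : R) v : 0 <= e ->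
  (forall i j, `|M i j| <= e) -> `|M *m v| <= p%:R * (e * `|v|).
Proof.
move=> e0 Me; apply: norm_cV_le => [|i]; first by rewrite !mulr_ge0.
rewrite mxE (le_trans (ler_norm_sum _ _ _))//.
rewrite (le_trans (ler_sum _ (_ : forall j, _ -> _ <= e * `|v|)))//.
  by move=> j _; rewrite normrM ler_pM// ler_coord_norm.
by rewrite sumr_const card_ord mulr_natl.
Qed.

Lemma normr_dotv_le a b : `|dotv a b| <= p%:R * (`|a| * `|b|).
Proof.
rewrite dotvE (le_trans (ler_norm_sum _ _ _))//.
rewrite (le_trans (ler_sum _ (_ : forall i, _ -> _ <= `|a| * `|b|)))//.
  by move=> i _; rewrite normrM ler_pM// ler_coord_norm.
by rewrite sumr_const card_ord mulr_natl.
Qed.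

End ColumnVectors.

Section ImplicitFunction.
Context {R : realType} {E : normedModType R} (bE : frame E) {p : nat}.
Variables (D1 : set E) (D2 : set 'cV[R]_p).
Variables (G : 'I_p -> E * 'cV[R]_p -> R) (us : E -> 'cV[R]_p).
Hypothesis oD1 : open D1.
Hypothesis segD2 : forall (u v : 'cV[R]_p) (t : R), D2 u -> D2 v ->
  0 <= t <= 1 -> D2 (u + t *: (v - u)).
Hypothesis C1G : forall i, Ck 1 (D1 `*` D2) (G i).

Definition Jac2 (y : E * 'cV[R]_p) : 'M[R]_p :=
  \matrix_(i, j) 'D_(0, delta_mx j ord0) (G i) y.

Hypothesis Jac2_coercive : forall z, D1 z -> exists2 rho : R, 0 < rho &
  forall u, D2 u -> forall v, rho * dotv v v <= dotv v (Jac2 (z, u) *m v).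
Hypothesis usD2 : forall z, D1 z -> D2 (us z).
Hypothesis usG : forall z i, D1 z -> G i (z, us z) = 0.

Lemma differentiable_G i z u : D1 z -> D2 u -> differentiable (G i) (z, u).
Proof. by move=> Dz Du; apply: (C1G i).1. Qed.

Lemma Jac2E i (y : E * 'cV[R]_p) (v : 'cV[R]_p) : D1 y.1 -> D2 y.2 ->
  'D_(0, v) (G i) y = (Jac2 y *m v) i ord0.
Proof.
case: y => z u /= Dz Du.
rewrite (derive_pairr (frame_cV p)); last exact: differentiable_G.
by rewrite mxE; apply: eq_bigr => j _; rewrite mxE mulrC.
Qed.

Lemma is_derive_dotG z u (w : 'cV[R]_p) (t : R) : D1 z -> D2 (u + t *: w) ->
  is_derive t 1 (fun t => \sum_i w i ord0 * G i (z, u + t *: w))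
    (dotv w (Jac2 (z, u + t *: w) *m w)).
Proof.
move=> Dz Du.
have zuE (s : R) : (z, u + s *: w) = (z, u) + s *: (0, w).
  by apply: injective_projections; rewrite /= ?scaler0 ?addr0.
rewrite (_ : (fun t => _) =
    \sum_(i < p) (w i ord0 \*: (fun s : R => G i ((z, u) + s *: (0, w))))).
  rewrite dotvE; apply: is_derive_sum => i.
  apply: is_deriveZ; rewrite -Jac2E// zuE; apply: is_derive_line.
  by apply/diff_derivable; rewrite -zuE; exact: differentiable_G.
by apply/funext => s; rewrite fct_sumE; apply: eq_bigr => i _; rewrite zuE.
Qed.

(** The pairing of [w] with [G] along the line has derivative w^T Jac2 w, so the mean value theorem
    applies. The interval is arbitrary because [us_lipschitz] uses different bounds [m] on two
    successive pieces. *)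
Lemma dotG_growth z u w (a b m : R) : D1 z -> a <= b ->
  (forall t, a <= t <= b -> D2 (u + t *: w)) ->
  (forall t, a <= t <= b -> m <= dotv w (Jac2 (z, u + t *: w) *m w)) ->
  m * (b - a) <=
    \sum_i w i ord0 * G i (z, u + b *: w) - \sum_i w i ord0 * G i (z, u + a *: w).
Proof.
move=> Dz ab Dw mw.
pose psi (t : R) := \sum_i w i ord0 * G i (z, u + t *: w).
have dpsi (t : R) : t \in `[a, b] ->
    is_derive t 1 psi (dotv w (Jac2 (z, u + t *: w) *m w)).
  by rewrite in_itv /= => /Dw; exact: is_derive_dotG.
have dpsi' (t : R) : t \in `]a, b[ ->
    is_derive t 1 psi (dotv w (Jac2 (z, u + t *: w) *m w)).
  by move=> tab; apply: dpsi; exact: subset_itv_oo_cc.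
have cpsi : {within `[a, b], continuous psi}.
  apply: continuous_in_subspaceT => t /set_mem tab.
  by apply/differentiable_continuous/derivable1_diffP; have [] := dpsi t tab.
have [t tab ->] := MVT_segment ab dpsi' cpsi.
by rewrite ler_wpM2r ?subr_ge0//; apply: mw; move: tab; rewrite in_itv.
Qed.

Lemma G_lipschitz z0 u0 i : D1 z0 -> D2 u0 -> exists2 K : R, 0 < K &
  \forall z \near z0, `|G i (z, u0) - G i (z0, u0)| <= K * `|z - z0|.
Proof.
move=> Dz0 Du0; have dGi := @differentiable_G i _ _ Dz0 Du0.
have [k k0 hk] := linear_lipschitz (diff_continuous dGi).
(* [k] bounds the differential and 1 the remainder, taken with e = 1. *)
exists (1 + k); first by rewrite addr_gt0.
have cz : {for z0, continuous (fun z => (z, u0))}.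
  exact: (@cvg_pair _ _ _ (nbhs z0) (nbhs z0) (nbhs u0) _ _ _ id (cst u0)
    (@cvg_id _ _) (cvg_cst _)).
have near1 : \forall z \near z0, `|G i (z, u0) - G i (z0, u0) -
    'd (G i) (z0, u0) ((z, u0) - (z0, u0))| <= 1 * `|(z, u0) - (z0, u0)|.
  exact: cz _ (differentiable_near_le dGi (@ltr01 R)).
apply: filterS near1 => z.
have -> : (z, u0) - (z0, u0) = (z - z0, 0).
  by apply: injective_projections; rewrite /= ?subrr.
have nz : `|(z - z0, 0) : E * 'cV[R]_p| = `|z - z0|.
  by rewrite prod_normE/= normr0; apply/max_idPl.
rewrite mul1r => hz; rewrite -[X in `|X|](subrK ('d (G i) (z0, u0) (z - z0, 0))).
rewrite (le_trans (ler_normD _ _))// mulrDl mul1r -{1}nz lerD//.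
by rewrite (le_trans (hk _))// nz.
Qed.

Lemma Jac2_near (y0 : E * 'cV[R]_p) (e : R) : (D1 `*` D2) y0 -> 0 < e ->
  \forall y \near y0, forall i j, `|Jac2 y i j - Jac2 y0 i j| <= e.
Proof.
move=> Dy0 e0; have FF : Filter (nbhs y0) by exact: _.
apply: (@filter_forall _ _ _ _ FF) => i; apply: (@filter_forall _ _ _ _ FF) => j.
have cJ : {for y0, continuous ('D_(0, delta_mx j ord0) (G i))}.
  exact: ((C1G i).2 (0, delta_mx j ord0) y0 Dy0).
move/cvgrPdist_le: cJ => /(_ _ e0); apply: filterS => y.
by rewrite !mxE distrC.
Qed.

(** With w = us z - us z0, the pairing of w with G (z, .) vanishes at us z and is at least -K |w| |z
    - z0| at us z0. Coercivity makes it grow by at least rho / 2 |w|^2 in between, whence the bound.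
    But rho / 2 is uniform only near (z0, us z0), and us z is not yet known to be close to us z0:
    this is why only an initial piece of the segment is used quantitatively. *)
Lemma us_lipschitz z0 : D1 z0 -> exists2 C : R, 0 < C &
  \forall z \near z0, `|us z - us z0| <= C * `|z - z0|.
Proof.
move=> Dz0; set u0 := us z0; have Du0 : D2 u0 := usD2 Dz0.
have [rho rho0 Jrho] := Jac2_coercive Dz0.
pose P : R := p%:R; have P0 : 0 <= P by exact: ler0n.
(* Moving each entry of the Jacobian by at most [e] changes the quadratic form by at most P^2 e
   |v|^2, which is below rho / 2 |v|^2; the + 1 keeps the denominator positive. *)
pose e := rho / (2 * (P * P + 1)).
have PP0 : 0 < P * P + 1 by rewrite ltr_wpDl ?mulr_ge0.
have e0 : 0 < e by rewrite divr_gt0// mulr_gt0.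
have /nbhs_ballP[r /= r0 hr] := @Jac2_near (z0, u0) _ (conj Dz0 Du0) e0.
have Jr z u v : ball z0 r z -> ball u0 r u ->
    rho / 2 * `|v| ^+ 2 <= dotv v (Jac2 (z, u) *m v).
  move=> zr ur; have {}hr := hr (z, u) (conj zr ur).
  have JM : `|dotv v ((Jac2 (z, u) - Jac2 (z0, u0)) *m v)| <= rho / 2 * `|v| ^+ 2.
    rewrite (le_trans (normr_dotv_le _ _))//.
    apply: (@le_trans _ _ (P * (`|v| * (P * (e * `|v|))))).
      rewrite ler_wpM2l// ler_wpM2l// normr_mulmx_le ?ltW// => i j.
      by have := hr i j; rewrite !mxE.
    have -> : P * (`|v| * (P * (e * `|v|))) = (P * P * e) * `|v| ^+ 2 by ring.
    rewrite ler_wpM2r ?sqr_ge0// /e mulrA ler_pdivrMr ?mulr_gt0//.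
    have -> : rho / 2 * (2 * (P * P + 1)) = P * P * rho + rho by field.
    by rewrite lerDl ltW.
  have := Jrho _ Du0 v; have := sqr_norm_le_dotv v.
  rewrite -(ler_pM2l rho0) => /le_trans/[apply] J0.
  have -> : Jac2 (z, u) = Jac2 (z0, u0) + (Jac2 (z, u) - Jac2 (z0, u0)).
    by rewrite subrKC.
  rewrite mulmxDl; move: JM J0; set M := _ *m v; set N := _ *m v.
  by rewrite dotvDr ler_norml => /andP[]; set a := `|v| ^+ 2; lra.
have [K K0 hK] : exists2 K : R, 0 < K &
    \forall z \near z0, forall w : 'cV[R]_p,
      - \sum_i w i ord0 * G i (z, u0) <= `|w| * (K * `|z - z0|).
  have [K_ K_0 hK] := @fin_all_exists2 _ _ _ _
    (fun i => @G_lipschitz z0 u0 i Dz0 Du0).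
  exists (1 + \sum_i K_ i).
    by rewrite ltr_pwDl// sumr_ge0// => i _; rewrite ltW.
  have near_all : \forall z \near z0, forall i,
      `|G i (z, u0) - G i (z0, u0)| <= K_ i * `|z - z0|.
    by apply: filter_forall => i; exact: hK.
  apply: filterS near_all => z {}hK w.
  rewrite (le_trans (ler_norm _))// normrN (le_trans (ler_norm_sum _ _ _))//.
  rewrite mulrDl mul1r mulrDr mulr_suml mulr_sumr ler_wpDl ?mulr_ge0//.
  apply: ler_sum => i _; rewrite normrM ler_pM// ?ler_coord_norm//.
  by have := hK i; rewrite (usG _ Dz0) subr0.
exists (2 * K / rho); first by rewrite divr_gt0// mulr_gt0.
(* Closer to [z0] than this, [|w| >= r] is impossible, by [key] with [t1 * |w| = r / 2]. *)
have c0 : 0 < r * rho / (4 * K) by rewrite divr_gt0 ?mulr_gt0.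
have nz0 : \forall z \near z0,
    D1 z /\ (ball z0 r z /\ `|z - z0| < r * rho / (4 * K)).
  apply: filterI; first exact: open_nbhs_nbhs.
  apply: filterI; first exact: nbhsx_ballx.
  by apply: filterS (nbhsx_ballx z0 _ c0) => z; rewrite -ball_normE /= distrC.
apply: filterS2 nz0 hK => z [Dz [zr zc]] hK.
set w := us z - u0; have [w0|w0] := eqVneq w 0.
  by rewrite w0 normr0 mulr_ge0// divr_ge0 ?mulr_ge0// ltW.
have nw0 : 0 < `|w| by rewrite normr_gt0.
have seg t : 0 <= t <= 1 -> D2 (u0 + t *: w).
  by apply: segD2 => //; exact: usD2.
(* Pairing G (z, .) with w on [us z0, us z], where it is monotone. The initial
   part t <= t1 lies in the ball where the Jacobian is uniformly coercive. *)
have key (t1 : R) : 0 <= t1 <= 1 -> t1 * `|w| < r ->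
    t1 * `|w| * (rho / 2) <= K * `|z - z0|.
  move=> /andP[t10 t11] t1r.
  have J1 : forall t, 0 <= t <= t1 ->
      rho / 2 * `|w| ^+ 2 <= dotv w (Jac2 (z, u0 + t *: w) *m w).
    move=> t /andP[t0 tt1]; apply: Jr => //; rewrite -ball_normE /= opprD addrA.
    rewrite subrr sub0r normrN normrZ ger0_norm//.
    by apply: le_lt_trans t1r; rewrite ler_wpM2r.
  have J2 : forall t, t1 <= t <= 1 -> 0 <= dotv w (Jac2 (z, u0 + t *: w) *m w).
    move=> t /andP[t0 tt1]; have [rz rz0 Jz] := Jac2_coercive Dz.
    apply: le_trans (Jz _ _ w); first by rewrite mulr_ge0 ?dotvv_ge0// ltW.
    by apply: seg; rewrite tt1 (le_trans t10).
  have seg1 t : 0 <= t <= t1 -> D2 (u0 + t *: w).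
    by move=> /andP[t0 tt1]; apply: seg; rewrite t0 (le_trans tt1).
  have seg2 t : t1 <= t <= 1 -> D2 (u0 + t *: w).
    by move=> /andP[t0 tt1]; apply: seg; rewrite tt1 (le_trans t10).
  have := dotG_growth Dz t10 seg1 J1; have := dotG_growth Dz t11 seg2 J2.
  have -> : \sum_i w i ord0 * G i (z, u0 + 1 *: w) = 0.
    by rewrite big1// => i _; rewrite scale1r /w subrKC usG// mulr0.
  have -> : \sum_i w i ord0 * G i (z, u0 + 0 *: w) =
      \sum_i w i ord0 * G i (z, u0).
    by apply: eq_bigr => i _; rewrite scale0r addr0.
  rewrite mul0r subr0 => g1 g2; have := hK w => {}hK.
  rewrite -(ler_pM2l nw0); apply: le_trans hK.
  have -> : `|w| * (t1 * `|w| * (rho / 2)) = rho / 2 * `|w| ^+ 2 * t1 by ring.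
  by move: g1 g2; set a := rho / 2 * _ * _; lra.
(* If [|w| < r], the whole segment lies in the ball and [t1 = 1] gives the estimate; otherwise
   [t1 = r / (2 * |w|)] contradicts the choice of the neighbourhood. *)
have [wr|wr] := ltP `|w| r.
  have := key 1; rewrite !mul1r lexx ler01 => /(_ isT wr).
  rewrite -(ler_pM2r (_ : 0 < 2 / rho)) ?divr_gt0//.
  have -> : `|w| * (rho / 2) * (2 / rho) = `|w| by field; rewrite gt_eqF.
  by have -> : K * `|z - z0| * (2 / rho) = 2 * K / rho * `|z - z0| by ring.
have t1w : r / (2 * `|w|) * `|w| = r / 2 by field; rewrite gt_eqF.
have := key (r / (2 * `|w|)); rewrite t1w divr_ge0 ?mulr_ge0 ?(ltW r0)//=.
rewrite ler_pdivrMr ?mulr_gt0// mul1r (le_trans wr) ?ler_peMl ?ler1n//.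
rewrite ltr_pdivrMr// ltr_pMr// ltr1n => /(_ isT isT).
move: zc; rewrite ltr_pdivlMr ?mulr_gt0// => zc zc'.
suff : False by [].
by move: zc zc'; set a := `|z - z0|; lra.
Qed.

Lemma Jac2_unitmx z u : D1 z -> D2 u -> Jac2 (z, u) \in unitmx.
Proof.
move=> Dz Du; have [rho rho0 Jrho] := Jac2_coercive Dz.
apply: coercive_unitmx => v v0; apply: lt_le_trans (Jrho u Du v).
by rewrite mulr_gt0// dotv_gt0.
Qed.

Lemma us_continuous z0 : D1 z0 -> {for z0, continuous us}.
Proof.
move=> Dz0; have [C C0 hC] := us_lipschitz Dz0.
apply/cvgrPdist_lt => e e0.
have eC0 : 0 < e / C by rewrite divr_gt0.
apply: filterS2 hC (nbhsx_ballx z0 _ eC0) => z hC.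
rewrite -ball_normE /= ltr_pdivlMr// mulrC distrC => zC.
by rewrite distrC (le_lt_trans hC).
Qed.

(** Expand 0 = G (z, us z) to first order at (z0, us z0) and apply the inverse Jacobian. The
    Lipschitz bound turns the remainder, small compared with the joint increment, into one small
    compared with [z - z0]. *)
Lemma us_derive z0 i : D1 z0 ->
  differentiable (fun z => us z i ord0) z0 /\
  forall v, 'D_v (fun z => us z i ord0) z0 =
    - \sum_j invmx (Jac2 (z0, us z0)) i j * 'D_(v, 0) (G j) (z0, us z0).
Proof.
move=> Dz0; have Du0 := usD2 Dz0; set y0 := (z0, us z0).
have dGj j : differentiable (G j) y0 by exact: differentiable_G.
set Ai := invmx (Jac2 y0).
pose l (v : E) : R := - \sum_j Ai i j * 'd (G j) y0 (v, 0).
have l_lin : linear l.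
  move=> a u v; rewrite /l scalerN -opprD scaler_sumr -big_split; congr (- _).
  apply: eq_bigr => j _ /=.
  have -> : (a *: u + v, 0) = a *: (u, 0) + (v, 0) :> E * 'cV[R]_p.
    by apply: injective_projections; rewrite /= ?scaler0 ?addr0.
  by rewrite linearP mulrDr scalerAr.
pose lM := GRing.isLinear.Build _ _ _ _ _ l_lin.
pose L : {linear E -> R} := HB.pack l lM.
have cL : continuous L.
  move=> v; rewrite /continuous_at /= /l; apply: cvgN.
  elim: (index_enum _) => [|j r IH].
    by rewrite big_nil; under eq_fun do rewrite big_nil; exact: cvg_cst.
  rewrite big_cons; under eq_fun do rewrite big_cons.
  apply: cvgD => //; apply: cvgM; first exact: cvg_cst.
  have cp : {for v, continuous (fun v : E => (v, 0 : 'cV[R]_p))}.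
    exact: (@cvg_pair _ _ _ (nbhs v) (nbhs v) (nbhs (0 : 'cV[R]_p)) _ _ _ id (cst 0)
      (@cvg_id _ _) (cvg_cst _)).
  have cd : continuous ('d (G j) y0) by exact: diff_continuous.
  have cdv := cd (v, 0); exact: (continuous_comp cp cdv).
have LE v : L v = l v by [].
clearbody L; have main (e : R) : 0 < e -> \forall z \near z0,
    `|us z i ord0 - us z0 i ord0 - L (z - z0)| <= e * `|z - z0|.
  move=> e0; have [C C0 hC] := us_lipschitz Dz0.
  pose S := 1 + \sum_j `|Ai i j|.
  have S0 : 0 < S by rewrite ltr_pwDl// sumr_ge0.
  have C10 : 0 < 1 + C by rewrite addr_gt0.
  (* [S] pays for the row of the inverse Jacobian, and [1 + C] for bounding the joint increment by
     that of z. *)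
  pose e' := e / (S * (1 + C)).
  have e'0 : 0 < e' by rewrite divr_gt0// mulr_gt0.
  have cy : {for z0, continuous (fun z => (z, us z))}.
    exact: (@cvg_pair _ _ _ (nbhs z0) (nbhs z0) (nbhs (us z0)) _ _ _ id us
      (@cvg_id _ _) (us_continuous Dz0)).
  have near_G : \forall z \near z0, forall j, `|G j (z, us z) - G j y0 -
      'd (G j) y0 ((z, us z) - y0)| <= e' * `|(z, us z) - y0|.
    apply: filter_forall => j.
    exact: cy _ (differentiable_near_le (dGj j) e'0).
  have nD1 := open_nbhs_nbhs (conj oD1 Dz0).
  apply: filterS3 nD1 hC near_G => z Dz {}hC hG.
  set w := us z - us z0.
  have yE : (z, us z) - y0 = (z - z0, 0) + (0, w).
    by apply: injective_projections; rewrite /= ?addr0 ?add0r.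
  have ny : `|(z, us z) - y0| <= (1 + C) * `|z - z0|.
    rewrite prod_normE /= ge_max mulrDl mul1r lerDl mulr_ge0 ?(ltW C0)//=.
    by rewrite (le_trans hC)// lerDr.
  (* Writing w as the inverse Jacobian applied to Jac2 w exhibits the error as a combination of the
     first-order terms of the [G j]. *)
  have -> : us z i ord0 - us z0 i ord0 - L (z - z0) =
      \sum_j Ai i j * ('d (G j) y0 (z - z0, 0) + (Jac2 y0 *m w) j ord0).
    rewrite LE opprK; under [RHS]eq_bigr do rewrite mulrDr.
    rewrite big_split addrC; congr (_ + _).
    have Aw : \sum_j Ai i j * (Jac2 y0 *m w) j ord0 = w i ord0.
      rewrite -[w in RHS]mul1mx -(mulVmx (Jac2_unitmx Dz0 Du0)) -mulmxA.
      by rewrite [in RHS]mxE.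
    by rewrite Aw !mxE.
  have bound j : `|'d (G j) y0 (z - z0, 0) + (Jac2 y0 *m w) j ord0| <=
      e' * ((1 + C) * `|z - z0|).
    have := hG j; rewrite usG// /y0 usG// subrr sub0r normrN yE.
    rewrite linearD /= -(deriveE (0, w))// -/y0 Jac2E// => /le_trans -> //.
    by rewrite -yE ler_wpM2l// ltW.
  rewrite (le_trans (ler_norm_sum _ _ _))//.
  apply: (@le_trans _ _ (\sum_j `|Ai i j| * (e' * ((1 + C) * `|z - z0|)))).
    by apply: ler_sum => j _; rewrite normrM ler_wpM2l.
  rewrite -mulr_suml; apply: (@le_trans _ _ (S * (e' * ((1 + C) * `|z - z0|)))).
    apply: ler_wpM2r; last by rewrite lerDr.
    by apply: mulr_ge0; [exact: ltW|apply: mulr_ge0; first exact: ltW].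
  have -> // : S * (e' * ((1 + C) * `|z - z0|)) = e * `|z - z0|.
  by rewrite /e'; field; rewrite !gt_eqF.
have [dus Dus] := near_le_differentiable cL main.
split=> // v; rewrite Dus LE /l; congr (- _); apply: eq_bigr => j _.
by rewrite deriveE.
Qed.

(** Order k + 1 uses order k of [us] inside the graph map z |-> (z, us z) and one derivative of [G];
    order 0 already rests on [C1G]. *)
Lemma Ck_us k : (forall i, Ck k (D1 `*` D2) (G i)) ->
  forall i, Ck k D1 (fun z => us z i ord0).
Proof.
elim: k => [|k IH] CG i.
  by move=> z Dz; apply/differentiable_continuous/(us_derive i Dz).1.
split=> [z Dz|v]; first exact: (us_derive i Dz).1.
have {}IH := IH (fun i => CkW (CG i)).
have Cgraph h : Ck k (D1 `*` D2) h -> Ck k D1 (fun z => h (z, us z)).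
  apply: (@Ck_comp _ _ _ (frame_prod bE (frame_cV p)) _ _ _ h
    (fun z => (z, us z))) => //.
    by move=> z Dz; split => //; exact: usD2.
  by move=> [j|j] /=; [apply: Ck_linear; exact: fcrd_continuous|exact: IH].
have Cs : Ck k D1 (fun z => - \sum_j invmx (Jac2 (z, us z)) i j *
    'D_(v, 0) (G j) (z, us z)).
  apply: CkN => //; apply: Ck_sum => // j; apply: CkM => //; last first.
    by apply: (Cgraph ('D_(v, 0) (G j))); exact: (CG j).2.
  apply: Ck_invmx => // [a b|z Dz]; last by apply: Jac2_unitmx => //; exact: usD2.
  apply: eq_Ck (Cgraph _ ((CG a).2 (0, delta_mx b ord0))) => // z _.
  by rewrite mxE.
by apply: eq_Ck Cs => // z /set_mem Dz; rewrite (us_derive i Dz).2.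
Qed.

End ImplicitFunction.

(** * Taylor remainder at the minimizer *)

Section ConvexInterior.
Context {R : realType} {E : normedModType R}.
Implicit Types (A : set E) (u v : E).

Lemma convex_set_segment A u v (t : R) : convex_set A -> A u -> A v ->
  0 <= t <= 1 -> A (u + t *: (v - u)).
Proof.
move=> cA /mem_set Au /mem_set Av /andP[t0 t1]; apply: set_mem.
have -> : u + t *: (v - u) = t *: v + (1 - t) *: u.
  by rewrite scalerBr scalerBl scale1r addrCA.
exact: (cA v u (Itv01 t0 t1) Av Au).
Qed.

(** For t < 1, displacing the point by delta amounts to displacing [u] by delta / (1 - t) with [v]
    fixed, so a ball of radius r about [u] yields one of radius (1 - t) r. For t = 1 the point is
    [v]. *)
Lemma interior_segment A u v (t : R) : convex_set A -> A° u -> A° v ->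
  0 <= t <= 1 -> A° (u + t *: (v - u)).
Proof.
move=> cA Au Av /andP[t0]; rewrite le_eqVlt => /predU1P[->|t1].
  by rewrite scale1r subrKC.
have t10 : 0 < 1 - t by rewrite subr_gt0.
move/nbhs_ballP: Au => [r /= r0 rA]; apply/nbhs_ballP.
exists ((1 - t) * r) => /=; first by rewrite mulr_gt0.
move=> w; rewrite -ball_normE /= => wr.
pose u' := u + (1 - t)^-1 *: (w - (u + t *: (v - u))).
have segE a : a + t *: (v - a) = (1 - t) *: a + t *: v.
  by rewrite scalerBr scalerBl scale1r addrCA addrC.
have -> : w = u' + t *: (v - u').
  rewrite segE /u' scalerDr scalerA divff ?gt_eqF// scale1r addrAC -segE.
  by rewrite addrC subrK.
apply: convex_set_segment => //; last 2 first.
- exact: interior_subset.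
- by rewrite t0 ltW.
apply: rA; rewrite -ball_normE /= /u' opprD addrA subrr sub0r normrN normrZ.
by rewrite gtr0_norm ?invr_gt0// mulrC ltr_pdivrMr// distrC mulrC.
Qed.

End ConvexInterior.

Lemma int01_FTC (R : realType) (F f : R -> R) :
  (forall t : R, 0 <= t <= 1 -> is_derive t 1 F (f t)) ->
  {within `[0, 1], continuous f} ->
  \int[@lebesgue_measure R]_(t in `[0, 1]) f t = F 1 - F 0.
Proof.
move=> dF cf.
have cF (t : R) : 0 <= t <= 1 -> {for t, continuous F}.
  by move=> /dF[dFt _]; apply/differentiable_continuous/derivable1_diffP.
rewrite /Rintegral (@continuous_FTC2 R f F)//.
- split.
  + by move=> t /subset_itv_oo_cc; rewrite in_itv /= => /dF[].
  + by apply: cvg_at_right_filter; apply: cF; rewrite lexx ler01.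
  + by apply: cvg_at_left_filter; apply: cF; rewrite lexx ler01.
- move=> t /subset_itv_oo_cc; rewrite in_itv /= => /dF[_ <-].
  by rewrite derive1E.
Qed.

Section Remainder.
Context {R : realType} {E : normedModType R} (bE : frame E) {p : nat}.
Local Notation mu := (@lebesgue_measure R).
Variables (D1 : set E) (D2 : set 'cV[R]_p) (us : E -> 'cV[R]_p) (k : nat).
Hypotheses (oD1 : open D1) (oD2 : open D2).
Hypothesis segD2 : forall (u v : 'cV[R]_p) (t : R), D2 u -> D2 v ->
  0 <= t <= 1 -> D2 (u + t *: (v - u)).
Hypothesis usD2 : forall z, D1 z -> D2 (us z).
Hypothesis Cus : forall i, Ck k D1 (fun z => us z i ord0).

Let seg (x : R * (E * 'cV[R]_p)) : 'cV[R]_p :=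
  us x.2.1 + x.1 *: (x.2.2 - us x.2.1).

Lemma Ck_segment_comp (h : E * 'cV[R]_p -> R) : Ck k (D1 `*` D2) h ->
  Ck k (D1 `*` D2) (fun w =>
    \int[mu]_(t in `[0, 1]) ((1 - t) * h (w.1, us w.1 + t *: (w.2 - us w.1)))).
Proof.
move=> Ch; have oD := open_setX oD1 oD2.
pose D3 : set (R * (E * 'cV[R]_p)) := setT `*` (D1 `*` D2).
have oD3 : open D3 by apply: open_setX => //; exact: openT.
have Clin (l : {linear (R * (E * 'cV[R]_p))%type -> R}) : continuous l -> Ck k D3 l.
  exact: Ck_linear.
have Ct : Ck k D3 (fun x => x.1).
  apply: (Clin (fst : {linear (R * (E * 'cV[R]_p))%type -> R})) => x.
  exact: cvg_fst.
have c21 : continuous (fun x : R * (E * 'cV[R]_p) => x.2.1).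
  by move=> x; apply: continuous_comp; [exact: cvg_snd|exact: cvg_fst].
have c22 : continuous (fun x : R * (E * 'cV[R]_p) => x.2.2).
  by move=> x; apply: continuous_comp; [exact: cvg_snd|exact: cvg_snd].
have Cz (l : {linear E -> R}) : continuous l -> Ck k D3 (fun x => l x.2.1).
  move=> cl; apply: (Clin (l \o fst \o snd)) => x.
  exact: continuous_comp (c21 x) (cl _).
have Cu i : Ck k D3 (fun x => x.2.2 i ord0).
  apply: (Clin (mxcoord i ord0 \o snd \o snd)) => x.
  have cc : continuous (@mxcoord R p 1 i ord0) by exact: coord_continuous.
  exact: continuous_comp (c22 x) (cc _).
have Cus3 i : Ck k D3 (fun x => us x.2.1 i ord0).
  apply: (@Ck_comp _ _ _ bE k D3 D1 (fun z => us z i ord0) (fun x => x.2.1)) => //.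
    by move=> x [_ []].
  by move=> j; apply: Cz; exact: fcrd_continuous.
have Cseg i : Ck k D3 (fun x => seg x i ord0).
  apply: eq_Ck (CkD oD3 (Cus3 i) (CkM oD3 Ct (CkB oD3 (Cu i) (Cus3 i)))) => //.
  by move=> x _; rewrite !mxE.
(* For t outside [0, 1] the point [seg x] may leave [D2], where nothing is known of [h]. [D4] is
   open and still contains [0, 1] times the domain. *)
pose D4 := D3 `&` [set x | D2 (seg x)].
have oD4 : open D4.
  rewrite openE => x [D3x D2x]; apply: filterI; first exact: open_nbhs_nbhs.
  have cseg : {for x, continuous seg}.
    apply: (frame_continuous (bF := frame_cV p)) => i.
    exact: Ck_continuous (Cseg i) D3x.
  by apply: cseg; exact: open_nbhs_nbhs.
have D43 : D4 `<=` D3 by move=> x [].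
apply: (@Ck_int01 _ _ (frame_prod bE (frame_cV p)) k _ D4
  (fun x => (1 - x.1) * h (x.2.1, seg x))) => //.
  move=> t [z u] t01 [/= Dz Du]; split => //.
  by apply: segD2 => //; exact: usD2.
apply: CkM => //; first by apply: CkB => //; [exact: Ck_cst|exact: Ck_subset Ct].
apply: (@Ck_comp _ _ _ (frame_prod bE (frame_cV p)) k D4 (D1 `*` D2) h
  (fun x => (x.2.1, seg x))) => //.
  by move=> x [[_ [D1x _]] D2x].
move=> [j|j] /=; apply: Ck_subset D43 _; last exact: Cseg.
by apply: Cz; exact: fcrd_continuous.
Qed.

End Remainder.

(** * Minimizer, Taylor expansion and positivity for the Hamiltonian *)

Section SumOfSquares.
Context {R : realType} {d p : nat}.
Local Notation mu := (@lebesgue_measure R).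
Local Notation Z := (R * 'cV[R]_d)%type.
Variables (T : R) (X : set 'cV[R]_d) (U : set 'cV[R]_p).
Variables (f : Z -> 'cV[R]_p -> 'cV[R]_d) (L : Z -> 'cV[R]_p -> R).
Variables (M : 'cV[R]_d -> R) (V Vt : Z -> R) (gV : Z -> 'cV[R]_d).
Variables (g : Z -> 'cV[R]_d) (B : Z -> 'M[R]_(d, p)).

Let Om1 := Omega1 f L Vt gV T X U.
Let Om2 := Omega2 U.
Let H := Hstar f L Vt gV.
(** The gradient of [Hstar] in u on the interior of [U]: the control-affine form of [f] contributes
    B^T gV, constant in u. *)
Let G (i : 'I_p) (w : Z * 'cV[R]_p) : R :=
  (grad (L w.1) w.2 + (B w.1)^T *m gV w.1) i ord0.

Hypothesis U_convex : convex_set U.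
Hypothesis V_HJB : HJB_solution f L V Vt gV T X U M.
Hypothesis f_affine : forall z u, time_state T X z -> U u ->
  f z u = g z + B z *m u.
Hypothesis L_strongly_convex : forall z, Om1 z ->
  twice_differentiable_on Om2 (L z) /\
  exists2 rho : R, 0 < rho &
    forall u, Om2 u -> psd_ge (hess (L z) u) rho%:M.

Let oOm1 : open Om1. Proof. exact: open_interior. Qed.
Let oOm2 : open Om2. Proof. exact: open_interior. Qed.
Let Om2U : Om2 `<=` U. Proof. exact: interior_subset. Qed.
Let segOm2 (u v : 'cV[R]_p) (t : R) : Om2 u -> Om2 v ->
  0 <= t <= 1 -> Om2 (u + t *: (v - u)).
Proof. exact: interior_segment. Qed.

Lemma Omega1_time_state z : Om1 z -> time_state T X z.
Proof. by move=> /interior_subset[]. Qed.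

Lemma Hstar_minimizer : exists us : Z -> 'cV[R]_p, forall z, Om1 z ->
  [/\ Om2 (us z), H z (us z) = 0 & forall v, U v -> 0 <= H z v].
Proof.
(* The implication stands under the existential so that choice yields a total function, with an
   arbitrary value off [Om1]. *)
suff ex z : exists u, Om1 z ->
    [/\ Om2 u, H z u = 0 & forall v, U v -> 0 <= H z v].
  by have [us usP] := choice ex; exists us.
have [Oz|nOz] := pselect (Om1 z); last by exists 0 => /nOz.
have Tz := Omega1_time_state Oz; have [HJ att _] := V_HJB.
have [u [Uu umin]] := att z Tz.
have := HJ z Tz; set A := [set _ | _ in _] => infA.
have lbA : lbound A (L z u + dotv (gV z) (f z u)) by move=> _ [v /umin + <-].
have Au : A (L z u + dotv (gV z) (f z u)) by exists u.
have infE : inf A = L z u + dotv (gV z) (f z u).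
  apply/eqP; rewrite eq_le ge_inf//=; last by exists (L z u + dotv (gV z) (f z u)).
  by apply: lb_le_inf => //; exists (L z u + dotv (gV z) (f z u)).
have Hu : H z u = 0 by rewrite /H /Hstar -addrA -infE.
have Hmin v : U v -> H z u <= H z v.
  by move=> /umin; rewrite /H /Hstar -!addrA lerD2l.
exists u => _; split=> // [|v /Hmin]; last by rewrite Hu.
by apply: (interior_subset Oz).2.
Qed.

Lemma near_line (u w : 'cV[R]_p) (t : R) : Om2 (u + t *: w) ->
  \forall r \near t, Om2 (u + r *: w).
Proof.
move=> Ou; have cl : {for t, continuous (fun r : R => u + r *: w)}.
  by apply: cvgD; [exact: cvg_cst|apply: cvgZr_tmp; exact: cvg_id].
by apply: cl; exact: open_nbhs_nbhs.
Qed.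

Lemma is_derive_Hstar z u w (t : R) : Om1 z -> Om2 (u + t *: w) ->
  is_derive t 1 (fun r => H z (u + r *: w))
    (\sum_i w i ord0 * G i (z, u + t *: w)).
Proof.
move=> Oz Ou; have Tz := Omega1_time_state Oz.
pose c0 := Vt z + dotv (gV z) (g z + B z *m u).
pose c1 := dotv (gV z) (B z *m w).
(* The affine form of [f] is available on [U] only, hence an identity near t rather than
   everywhere. *)
have HE : \forall r \near t, L z (u + r *: w) + (c0 + r * c1) = H z (u + r *: w).
  apply: filterS (near_line Ou) => r /Om2U Ur; rewrite /H /Hstar f_affine//.
  by rewrite mulmxDr -scalemxAr [g z + _]addrA dotvDr dotvZr /c0 /c1; ring.
apply: (near_eq_is_derive HE).
have dL : differentiable (L z) (u + t *: w).
  by apply: ((L_strongly_convex Oz).1 _ Ou).1.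
have -> : \sum_i w i ord0 * G i (z, u + t *: w) = 'D_w (L z) (u + t *: w) + c1.
  have -> : c1 = dotv w ((B z)^T *m gV z).
    by rewrite dotvC /c1 /dotv trmx_mul trmxK mulmxA.
  rewrite (derive_frame (frame_cV p))//= dotvE -big_split; apply: eq_bigr => i _.
  by rewrite /G /= [in LHS]mxE [grad _ _ i ord0]mxE mulrDr.
have dc : is_derive t 1 (fun r : R => c0 + r * c1) c1.
  have -> : (fun r : R => c0 + r * c1) = cst c0 + c1 \*: (@id R).
    by apply/funext => r; rewrite !fctE /= mulrC.
  by apply: is_derive_eq; rewrite add0r [LHS]mulr1.
have dLw := is_derive_line (diff_derivable (v := w) dL).
exact: (is_deriveD dLw dc).
Qed.

(** B^T gV is independent of u, so the difference quotients of both sides coincide, at every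
    point. *)
Lemma Jac2_hess (w : Z * 'cV[R]_p) : Jac2 G w = hess (L w.1) w.2.
Proof.
apply/matrixP => i j; rewrite !mxE /derive.
pose e : 'cV[R]_p := delta_mx j ord0.
suff -> : (fun k : R => k^-1 *: ((G i \o shift w) (k *: (0, e)) - G i w)) =
    (fun k : R => k^-1 *: (((fun y => grad (L w.1) y i ord0) \o shift w.2) (k *: e)
      - grad (L w.1) w.2 i ord0)) by [].
apply/funext => k /=; congr (_ *: _).
have subE (a b q : 'cV[R]_p) :
    (a + q) i ord0 - (b + q) i ord0 = a i ord0 - b i ord0.
  by rewrite !mxE; ring.
by case: w => z u; rewrite /G /= scaler0 add0r subE.
Qed.

(** Fermat's rule along each coordinate line, a neighbourhood of [u] on it being admissible since
    [u] is interior. *)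
Lemma Hstar_critical z u i : Om1 z -> Om2 u -> H z u = 0 ->
  (forall v, U v -> 0 <= H z v) -> G i (z, u) = 0.
Proof.
move=> Oz Ou Hu Hmin.
pose e : 'cV[R]_p := delta_mx i ord0.
have u0 : u + 0 *: e = u by rewrite scale0r addr0.
have Ou0 : Om2 (u + 0 *: e) by rewrite u0.
have /nbhs_ballP[r /= r0 hr] := near_line Ou0.
have rO t : t \in `]- r, r[ -> Om2 (u + t *: e).
  rewrite in_itv /= -ltr_norml => tr; apply: hr.
  by rewrite -ball_normE /= sub0r normrN.
have d0 := is_derive_Hstar Oz Ou0.
have : is_derive (0 : R) 1 (fun t => H z (u + t *: e)) 0.
  apply: (@derive1_at_min _ _ (- r) r) => //.
  - by rewrite ge0_cp// ltW.
  - by move=> t /rO Ot; have [] := is_derive_Hstar Oz Ot.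
  - by rewrite in_itv /= oppr_lt0 r0.
  - by move=> t /rO /Om2U /Hmin; rewrite u0 Hu.
move=> [_]; have [_ ->] := d0; rewrite u0 (bigD1 i)//= big1 ?addr0 => [|j ji].
  by rewrite mxE !eqxx mul1r.
by rewrite mxE (negPf ji) mul0r.
Qed.

Lemma hess_coercive z : Om1 z -> exists2 rho : R, 0 < rho &
  forall u, Om2 u -> forall v, rho * dotv v v <= dotv v (hess (L z) u *m v).
Proof.
move=> Oz; have [_ [rho rho0 hrho]] := L_strongly_convex Oz.
exists rho => // u Ou v; have [_ /(_ v)] := hrho u Ou.
by rewrite mulmxBl mul_scalar_mx -scaleNr dotvDr dotvZr mulNr subr_ge0.
Qed.

(** Symmetry is read off [psd_ge], the scalar matrix being symmetric, and not derived from equality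
    of mixed derivatives. *)
Lemma hess_sym z u : Om1 z -> Om2 u -> (hess (L z) u)^T = hess (L z) u.
Proof.
move=> Oz Ou; have [_ [rho _ hrho]] := L_strongly_convex Oz.
by have [] := hrho u Ou; rewrite linearB /= tr_scalar_mx => /addIr.
Qed.

Variable s : nat.
Hypothesis s_ge1 : (1 <= s)%N.
Hypothesis hessL_Cs : forall i j,
  Ck s (Om1 `*` Om2) (fun w => hess (L w.1) w.2 i j).
Hypothesis gradH_Cs : forall i, Ck s (Om1 `*` Om2) (G i).

Variable us : Z -> 'cV[R]_p.
Hypothesis usP : forall z, Om1 z ->
  [/\ Om2 (us z), H z (us z) = 0 & forall v, U v -> 0 <= H z v].

Let usO z : Om1 z -> Om2 (us z). Proof. by move=> /usP[]. Qed.

Let bZ : frame Z := frame_prod frameR (frame_cV d).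

Let C1G i : Ck 1 (Om1 `*` Om2) (G i).
Proof. exact: Ck_leq (gradH_Cs i). Qed.

Let usG z i : Om1 z -> G i (z, us z) = 0.
Proof. by move=> Oz; have [Ou Hu Hmin] := usP Oz; apply: Hstar_critical. Qed.

Lemma Ck_minimizer i : Ck s Om1 (fun z => us z i ord0).
Proof.
apply: (Ck_us bZ oOm1 segOm2 C1G) => // z Oz.
have [rho rho0 hrho] := hess_coercive Oz.
by exists rho => // u Ou v; rewrite Jac2_hess; exact: hrho.
Qed.

Definition remainder (w : Z * 'cV[R]_p) : 'M[R]_p :=
  \matrix_(i, j) \int[mu]_(t in `[0, 1])
    ((1 - t) * hess (L w.1) (us w.1 + t *: (w.2 - us w.1)) i j).

Lemma Ck_remainder i j : Ck s (Om1 `*` Om2) (fun w => remainder w i j).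
Proof.
have := Ck_segment_comp bZ oOm1 oOm2 segOm2 usO Ck_minimizer (hessL_Cs i j).
by apply: eq_Ck => [|w _]; [exact: open_setX|rewrite mxE].
Qed.

(** A single sum over pairs of indices is the shape that [int01_sum] expects. *)
Lemma quadE (A : 'M[R]_p) (v : 'cV[R]_p) : dotv v (A *m v) =
  \sum_(ij : 'I_p * 'I_p) (v ij.1 ord0 * v ij.2 ord0) * A ij.1 ij.2.
Proof.
rewrite dotvE -(pair_bigA _ (fun i j => v i ord0 * v j ord0 * A i j)) /=.
apply: eq_bigr => i _; rewrite mxE mulr_sumr; apply: eq_bigr => j _; ring.
Qed.

Lemma remainder_quad z u v : Om1 z -> Om2 u ->
  {within `[0, 1], continuous (fun t =>
    (1 - t) * dotv v (hess (L z) (us z + t *: (u - us z)) *m v))} /\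
  dotv v (remainder (z, u) *m v) = \int[mu]_(t in `[0, 1])
    ((1 - t) * dotv v (hess (L z) (us z + t *: (u - us z)) *m v)).
Proof.
move=> Oz Ou.
pose h (ij : 'I_p * 'I_p) (t : R) :=
  (1 - t) * hess (L z) (us z + t *: (u - us z)) ij.1 ij.2.
have ch ij : {within `[0, 1], continuous (h ij)}.
  apply: continuous_in_subspaceT => t /set_mem /=; rewrite in_itv /= => t01.
  apply: cvgM; first by apply: cvgB; [exact: cvg_cst|exact: cvg_id].
  have cseg : {for t, continuous (fun t : R => (z, us z + t *: (u - us z)))}.
    have cu : {for t, continuous (fun t : R => us z + t *: (u - us z))}.
      by apply: cvgD; [exact: cvg_cst|apply: cvgZr_tmp; exact: cvg_id].
    exact: (@cvg_pair _ _ _ (nbhs t) (nbhs z) _ _ _ _ (cst z) _ (cvg_cst _) cu).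
  have Ozt : (Om1 `*` Om2) (z, us z + t *: (u - us z)).
    by split => //=; apply: segOm2 => //; exact: usO.
  exact: (continuous_comp cseg (Ck_continuous (hessL_Cs ij.1 ij.2) Ozt)).
have [cS iS] := int01_sum (index_enum _)
  (fun ij : 'I_p * 'I_p => v ij.1 ord0 * v ij.2 ord0) ch.
have hE : (fun t => (1 - t) * dotv v (hess (L z) (us z + t *: (u - us z)) *m v)) =
    (fun t => \sum_(ij : 'I_p * 'I_p) v ij.1 ord0 * v ij.2 ord0 * h ij t).
  apply/funext => t; rewrite quadE mulr_sumr; apply: eq_bigr => ij _.
  by rewrite /h mulrCA.
rewrite hE; split=> //.
by rewrite iS quadE; apply: eq_bigr => ij _; rewrite mxE.
Qed.

(* Along the segment from the minimizer, phi (t) = H (us + t (u - us)) has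
   phi (0) = phi' (0) = 0, and (1 - t) phi'' is the derivative of
   (1 - t) phi' + phi. *)
Lemma Hstar_taylor z u : Om1 z -> Om2 u ->
  H z u = dotv (u - us z) (remainder (z, u) *m (u - us z)).
Proof.
move=> Oz Ou; have [Os Hs _] := usP Oz; set w := u - us z.
have [cR ->] := remainder_quad w Oz Ou.
pose phi (t : R) := H z (us z + t *: w).
pose phi' (t : R) := \sum_i w i ord0 * G i (z, us z + t *: w).
pose phi'' (t : R) := dotv w (hess (L z) (us z + t *: w) *m w).
have segO (t : R) : 0 <= t <= 1 -> Om2 (us z + t *: w) by exact: segOm2.
have dphi (t : R) : 0 <= t <= 1 -> is_derive t 1 phi (phi' t).
  by move=> /segO; exact: is_derive_Hstar.
have dphi' (t : R) : 0 <= t <= 1 -> is_derive t 1 phi' (phi'' t).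
  move=> /segO Ot; have := is_derive_dotG C1G Oz Ot.
  by rewrite Jac2_hess.
have dF (t : R) : 0 <= t <= 1 ->
    is_derive t 1 ((cst 1 - id) * phi' + phi) ((1 - t) * phi'' t).
  move=> t01; have d1 := dphi t t01; have d2 := dphi' t t01.
  by apply: is_derive_eq; rewrite !fctE /GRing.scale/=; ring.
rewrite (int01_FTC dF cR) !fctE subrr mul0r add0r subr0 mul1r /phi /phi'.
rewrite scale1r scale0r addr0 subrKC Hs addr0 [X in _ - X]big1 ?subr0// => i _.
by rewrite usG// mulr0.
Qed.

Lemma remainder_posdef z u : Om1 z -> Om2 u -> posdef (remainder (z, u)).
Proof.
move=> Oz Ou; have Os := usO Oz.
have segO (t : R) : 0 <= t <= 1 -> Om2 (us z + t *: (u - us z)) by exact: segOm2.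
split.
  apply/matrixP => i j; rewrite !mxE; apply: eq_Rintegral => t.
  rewrite inE /= in_itv /= => /segO Ot; congr (_ * _).
  by rewrite -[in RHS](hess_sym Oz Ot) [RHS]mxE.
move=> v v0; have [cR ->] := remainder_quad v Oz Ou.
have [rho rho0 hrho] := hess_coercive Oz.
pose c := rho * dotv v v; have c0 : 0 < c by rewrite mulr_gt0// dotv_gt0.
have cc : continuous (fun t : R => (1 - t) * c).
  move=> t; apply: cvgM; last exact: cvg_cst.
  by apply: cvgB; [exact: cvg_cst|exact: cvg_id].
have cw : {within `[0, 1], continuous (fun t : R => (1 - t) * c)}.
  exact: continuous_subspaceT.
(* The integrand dominates (1 - t) c, whose primitive - c / 2 (1 - t)^2 gives the integral c / 2 >
   0. *)
have dF (t : R) : 0 <= t <= 1 ->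
    is_derive t 1 (- (c / 2) \*: ((cst 1 - id) * (cst 1 - id))) ((1 - t) * c).
  by move=> _; apply: is_derive_eq; rewrite !fctE /GRing.scale/=; field.
apply: (@lt_le_trans _ _ (\int[mu]_(t in `[0, 1]) ((1 - t) * c))).
  rewrite (int01_FTC dF cw) !fctE /= subrr subr0 /GRing.scale/=.
  by rewrite !(mulr0, mulr1) sub0r opprK divr_gt0.
apply: le_int01 => // t t01; apply: ler_wpM2l; last exact/hrho/segO.
by rewrite subr_ge0; case/andP: t01.
Qed.

End SumOfSquares.

Theorem theorem1 (R : realType) (d p s : nat)
    (d_ge1 : (1 <= d)%N) (p_ge1 : (1 <= p)%N) (s_ge1 : (1 <= s)%N)
    (T : R) (T_gt0 : 0 < T)
    (X : set 'cV[R]_d) (U : set 'cV[R]_p)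
    (X_compact : compact X) (U_compact : compact U) (U_convex : convex_set U)
    (f : R * 'cV[R]_d -> 'cV[R]_p -> 'cV[R]_d)
    (L : R * 'cV[R]_d -> 'cV[R]_p -> R)
    (M : 'cV[R]_d -> R)
    (V Vt : R * 'cV[R]_d -> R) (gV : R * 'cV[R]_d -> 'cV[R]_d)
    (V_C1 : C1_within (time_state T X) V Vt gV)
    (V_HJB : HJB_solution f L V Vt gV T X U M)
    (g : R * 'cV[R]_d -> 'cV[R]_d) (B : R * 'cV[R]_d -> 'M[R]_(d, p))
    (f_affine : forall z u, time_state T X z -> U u ->
       f z u = g z + B z *m u)
    (L_strongly_convex : forall z, Omega1 f L Vt gV T X U z ->
       twice_differentiable_on (Omega2 U) (L z) /\
       exists2 rho : R, 0 < rho &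
         forall u, Omega2 U u -> psd_ge (hess (L z) u) rho%:M)
    (hessL_Cs : forall i j, Ck s (Omega f L Vt gV T X U)
       (fun w => hess (L w.1) w.2 i j))
    (gradH_Cs : forall i, Ck s (Omega f L Vt gV T X U)
       (fun w => (grad (L w.1) w.2 + (B w.1)^T *m gV w.1) i ord0)) :
  exists w : 'I_p -> R * 'cV[R]_d * 'cV[R]_p -> R,
    (forall j, Ck s (Omega f L Vt gV T X U) (w j)) /\
    (forall z u, Omega f L Vt gV T X U (z, u) ->
       Hstar f L Vt gV z u = \sum_(j < p) w j (z, u) ^+ 2).
Proof.
have [us usP] := Hstar_minimizer V_HJB.
have oO : open (Omega f L Vt gV T X U).
  by apply: open_setX; exact: open_interior.
have Cus := Ck_minimizer U_convex f_affine L_strongly_convex s_ge1 gradH_Cs usP.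
have CQ := Ck_remainder U_convex f_affine L_strongly_convex s_ge1 hessL_Cs
  gradH_Cs usP.
have pQ w : Omega f L Vt gV T X U w -> posdef (remainder L us w).
  case: w => z u [Oz Ou].
  exact: (remainder_posdef U_convex L_strongly_convex hessL_Cs usP).
have [W [CW WQ]] := Ck_cholesky oO CQ pQ.
exists (fun j w => (W w *m (w.2 - us w.1)) j ord0); split=> [j|z u Ozu].
  have Ccoord i : Ck s (Omega f L Vt gV T X U)
      (fun w => w.2 i ord0 - us w.1 i ord0).
    apply: CkB => //.
      apply: (Ck_linear s _ (l := mxcoord i ord0 \o snd)) => w.
      by apply: continuous_comp; [exact: cvg_snd|exact: coord_continuous].
    (* [us] is regular as a function of z; composition with the first projection makes it regular on
       [Omega]. *)
    pose bZ := frame_prod (@frameR R) (frame_cV d).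
    have sub w : Omega f L Vt gV T X U w -> Omega1 f L Vt gV T X U w.1 by case.
    have Cfst (k : fidx bZ) :
        Ck s (Omega f L Vt gV T X U) (fun w => fcrd k w.1).
      apply: (Ck_linear s _ (l := fcrd k \o fst)) => w.
      by apply: continuous_comp; [exact: cvg_fst|exact: fcrd_continuous].
    exact: (Ck_comp oO sub Cfst (Cus i)).
  apply: eq_Ck (Ck_sum (index_enum _) predT oO
    (fun i => CkM oO (CW j i) (Ccoord i))) => //.
  by move=> w _; rewrite mxE; apply: eq_bigr => i _; rewrite !mxE.
have [Oz Ou] := Ozu.
rewrite (Hstar_taylor U_convex f_affine L_strongly_convex s_ge1 hessL_Cs
  gradH_Cs usP)//.
rewrite -WQ// -mulmxA /dotv mulmxA -trmx_mul -/(dotv _ _) dotvE.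
by apply: eq_bigr => j _; rewrite expr2.
Qed.
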